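(* Suppose $R$ is a numerical semigroup ring that is not a DVR, with maximal ideal $\mathfrak m$. Then $R$ has minimal multiplicity if and only if $Z_1(\mathfrak m)\cong\mathfrak m^{\oplus(e(R)-1)}$ as $R$-modules.
   Context: A numerical semigroup ring is a ring $k[t^{a_1},\dots,t^{a_s}]$ or its completion $k[\![t^{a_1},\dots,t^{a_s}]\!]$, where $k$ is a field and $a_1<\dots<a_s$ are positive integers with $\gcd$ equal to $1$; $\mathfrak m=(t^{a_1},\dots,t^{a_s})$. In the graded case ''not a DVR'' means $R\neq k[t]$. $e(R)$ is the Hilbert-Samuel multiplicity of $R$ with respect to $\mathfrak m$ (equal to the smallest positive element of the semigroup); $R$ has minimal multiplicity if $e(R)=\mu_R(\mathfrak m)$, the minimal number of generators of $\mathfrak m$. For a minimal generating set $x_1,\dots,x_n$ of $\mathfrak m$, $Z_1(\mathfrak m)$ is the module of first Koszul cycles, i.e. the kernel of $R^{\oplus n}\to\mathfrak m$, $e_i\mapsto x_i$. *)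

(* Defs.v *)
From HB Require Import structures.
From mathcomp Require Import all_boot all_order all_algebra.
From mathcomp Require Import boolp classical_sets functions.

Set Implicit Arguments.
Unset Strict Implicit.
Unset Printing Implicit Defensive.

Import Order.TTheory GRing.Theory Num.Theory.
Local Open Scope classical_set_scope.
Local Open Scope ring_scope.

Section Modules.
Context {R : comNzRingType}.

Definition submodule (V : lmodType R) (A : set V) : Prop :=
  A 0 /\ forall (c : R) u v, A u -> A v -> A (c *: u + v).

Definition submod_span (V : lmodType R) (G : set V) : set V :=
  smallest (@submodule V) G.

(* Ideals are sets of elements of R; as modules they live in R^o. *)
Definition ideal (I : set R) : Prop := @submodule R^o I.

Definition ideal_span (G : set R) : set R := @submod_span R^o G.

Definition ideal_pow (I : set R) (n : nat) : set R :=
  ideal_span [set y | exists2 x : 'I_n -> R,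
                        (forall i, I (x i)) & y = \prod_(i < n) x i].

(* Isomorphism of the submodules A of U and B of V: an R-linear bijection
   A -> B (the values of f outside A are irrelevant). *)
Definition submodule_iso (U V : lmodType R) (A : set U) (B : set V) : Prop :=
  exists2 f : U -> V, set_bij A B f &
    forall (c : R) u v, A u -> A v -> f (c *: u + v) = c *: f u + f v.

(* The direct sum I^n of n copies of an ideal, inside R^n. *)
Definition ideal_dsum (I : set R) (n : nat) : set 'rV[R]_n :=
  [set v : 'rV[R]_n | forall j, I (v 0 j)].

Definition generates (n : nat) (x : 'I_n -> R) (I : set R) : Prop :=
  ideal_span (range x) = I.

(* mu_R(I), the minimal number of generators
   (with value 0 if I is not finitely generated). *)
Definition mu (I : set R) : nat :=
  get [set n | (exists x : 'I_n -> R, generates x I) /\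
               forall p (y : 'I_p -> R), generates y I -> (n <= p)%N].

(* Generating sets with mu_R(I) elements. Over a local ring these are the
   irredundant generating sets; in the graded case every irredundant
   homogeneous generating set of a homogeneous maximal ideal is one. *)
Definition minimal_generators (n : nat) (x : 'I_n -> R) (I : set R) : Prop :=
  n = mu I /\ generates x I.

(* First Koszul cycles: the kernel of R^n -> R, e_i |-> x_i. *)
Definition Z1 (n : nat) (x : 'I_n -> R) : set 'rV[R]_n :=
  [set r : 'rV[R]_n | \sum_(i < n) r 0 i * x i = 0].

(* Chains of submodules from W up to V with l strict inclusions; they correspond
   to the chains of submodules of V / W. *)
Definition submodule_chain (M : lmodType R) (W V : set M) (l : nat) : Prop :=
  exists c : nat -> set M,
    [/\ c 0%N = W, c l = V, forall i, (i <= l)%N -> submodule (c i) &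
        forall i, (i < l)%N -> c i `<` c i.+1].

(* The module R / I has finite length l. *)
Definition colength (I : set R) (l : nat) : Prop :=
  @submodule_chain R^o I setT l /\
  forall l', @submodule_chain R^o I setT l' -> (l' <= l)%N.

(* Hilbert-Samuel multiplicity: for n >> 0, length(R / I^n) is the value at n
   of a polynomial of some degree d, and the multiplicity is d! times its
   leading coefficient. *)
Definition has_multiplicity (I : set R) (e : nat) : Prop :=
  exists (P : {poly rat}) (N : nat),
    (forall n, (N <= n)%N ->
       exists2 l : nat, colength (ideal_pow I n) l & P.[n%:R] = l%:R) /\
    e%:R = ((size P).-1)`!%:R * lead_coef P.

Definition multiplicity (I : set R) : nat := get (has_multiplicity I).

Definition minimal_multiplicity (I : set R) : Prop := multiplicity I = mu I.

Definition maximal_ideal (M : set R) : Prop :=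
  [/\ ideal M, M <> setT &
      forall J, ideal J -> M `<=` J -> J = M \/ J = setT].

(* A principal ideal domain with a unique maximal ideal, which is nonzero. *)
Definition is_DVR : Prop :=
  [/\ forall x y : R, x * y = 0 -> x = 0 \/ y = 0,
      forall I : set R, ideal I -> exists x, I = ideal_span [set x] &
      exists M : set R, [/\ maximal_ideal M, M <> [set 0] &
                            forall M', maximal_ideal M' -> M' = M]].

End Modules.

Arguments is_DVR : clear implicits.
Arguments ideal_dsum {R} I n _.

(* Formal power series k[[t]], given by their coefficients. *)
Definition fps (k : fieldType) : Type := nat -> k.

Section Series.
Variable k : fieldType.

HB.instance Definition _ := GRing.Zmodule.copy (fps k) (nat -> k).

Definition series_of_poly (p : {poly k}) : fps k := fun n => p`_n.

Definition series_mul (f g : fps k) : fps k :=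
  fun n => \sum_(i < n.+1) f i * g (n - i)%N.

Definition series_trunc (n : nat) (f : fps k) : {poly k} :=
  \poly_(i < n) f i.

Lemma series_mul_coef n (f g : fps k) (p q : {poly k}) :
    (forall i, (i <= n)%N -> f i = p`_i) ->
    (forall i, (i <= n)%N -> g i = q`_i) ->
  series_mul f g n = (p * q)`_n.
Proof.
move=> fp gq; rewrite coefM; apply: eq_bigr => i _.
by rewrite fp -1?ltnS // gq ?leq_subr.
Qed.

Lemma coef_series_trunc n m (f : fps k) i :
  (i <= n)%N -> (n < m)%N -> f i = (series_trunc m f)`_i.
Proof. by move=> le_in lt_nm; rewrite coef_poly (leq_ltn_trans le_in lt_nm). Qed.

Lemma series_mulE n m (f g : fps k) :
  (n < m)%N ->
  series_mul f g n = (series_trunc m f * series_trunc m g)`_n.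
Proof.
by move=> lt_nm; apply: series_mul_coef => i le_in; apply: (@coef_series_trunc n).
Qed.

Lemma series_mulA : associative series_mul.
Proof.
move=> f g h; apply/funext => n.
have T u i : (i <= n)%N -> u i = (series_trunc n.+1 u)`_i.
  by move=> le_in; apply: (@coef_series_trunc n).
rewrite (@series_mul_coef n f _ _ (series_trunc n.+1 g * series_trunc n.+1 h)
           (T f)); last by move=> i le_in; apply: series_mulE.
rewrite (@series_mul_coef n _ h (series_trunc n.+1 f * series_trunc n.+1 g) _
           _ (T h)) ?mulrA //.
by move=> i le_in; apply: series_mulE.
Qed.

Lemma series_mulC : commutative series_mul.
Proof.
by move=> f g; apply/funext => n; rewrite !(series_mulE _ _ (ltnSn n)) mulrC.
Qed.

Lemma series_mul1 : left_id (series_of_poly 1) series_mul.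
Proof.
move=> f; apply/funext => n.
rewrite (@series_mul_coef n _ f 1 (series_trunc n.+1 f)) ?mul1r //.
  by rewrite -(@coef_series_trunc n).
by move=> i le_in; apply: (@coef_series_trunc n).
Qed.

Lemma series_mulDl : left_distributive series_mul +%R.
Proof.
move=> f g h; apply/funext => n.
rewrite -[RHS]/(series_mul f h n + series_mul g h n) -big_split /=.
by apply: eq_bigr => i _; rewrite mulrDl.
Qed.

Lemma series_oner_neq0 : series_of_poly 1 != 0.
Proof.
apply/eqP => /(congr1 (fun f : fps k => f 0%N)).
rewrite /series_of_poly coef1 => /eqP; apply/negP; exact: oner_neq0.
Qed.

HB.instance Definition _ := GRing.Zmodule_isComNzRing.Build (fps k)
  series_mulA series_mulC series_mul1 series_mulDl series_oner_neq0.

End Series.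

Definition numerical_generators (a : seq nat) : Prop :=
  [/\ sorted ltn a, all (fun i => 0 < i)%N a & \big[gcdn/0%N]_(i <- a) i = 1%N].

Section SemigroupRings.
Variables (k : fieldType) (a : seq nat).

(* k[t^{a_1}, ..., t^{a_s}] as a subset of k[t] *)
Definition poly_subalg : set {poly k} :=
  smallest (fun A : set {poly k} => GRing.subalg_closed [in A])
           [set 'X^i | i in [set` a]].

(* Its completion k[[t^{a_1}, ..., t^{a_s}]] as a subset of k[[t]]: the closure
   for the t-adic topology, which induces on k[t^{a_1}, ..., t^{a_s}] the adic
   topology of its maximal ideal (t^{a_1}, ..., t^{a_s}). *)
Definition series_subalg : set (fps k) :=
  [set f | forall n, exists2 p, poly_subalg p &
             forall i, (i < n)%N -> f i = p`_i].

Definition semigroup : set nat :=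
  [set n | exists c : nat -> nat, n = (\sum_(i <- a) c i * i)%N].

Lemma poly_subalg_closed : GRing.subalg_closed [in poly_subalg].
Proof.
split=> [|c u v /set_mem Su /set_mem Sv|u v /set_mem Su /set_mem Sv];
  apply/mem_set => A /[dup] AP [[A1 AL AM] _]; apply/set_mem => //.
- by apply: AL; apply/mem_set; [apply: Su|apply: Sv].
- by apply: AM; apply/mem_set; [apply: Su|apply: Sv].
Qed.

Lemma series_subalg_closed : GRing.subring_closed [in series_subalg].
Proof.
have [S1 SL SM] := poly_subalg_closed.
split=> [|u v /set_mem Su /set_mem Sv|u v /set_mem Su /set_mem Sv];
  apply/mem_set => n.
- by exists 1 => //; apply/set_mem.
- have [p Sp up] := Su n; have [q Sq vq] := Sv n; exists (p - q).
    apply/set_mem; rewrite -[p]scale1r addrC -[- q]scaleN1r scale1r.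
    by apply: SL; apply/mem_set.
  by move=> i lt_in; rewrite coefB -up // -vq.
- have [p Sp up] := Su n; have [q Sq vq] := Sv n; exists (p * q).
    by apply/set_mem/SM; apply/mem_set.
  move=> i lt_in; apply: series_mul_coef => j le_ji.
    by apply: up; apply: leq_ltn_trans lt_in.
  by apply: vq; apply: leq_ltn_trans lt_in.
Qed.

Definition in_poly_subalg : {pred {poly k}} := [in poly_subalg].
Definition in_series_subalg : {pred fps k} := [in series_subalg].

HB.instance Definition _ := GRing.isSubringClosed.Build {poly k}
  in_poly_subalg (GRing.subalg_closedBM poly_subalg_closed).
HB.instance Definition _ := GRing.isSubringClosed.Build (fps k)
  in_series_subalg series_subalg_closed.

Record poly_sgring := PolySgring
  { poly_sgval :> {poly k}; poly_sgvalP : poly_sgval \in in_poly_subalg }.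
Record series_sgring := SeriesSgring
  { series_sgval :> fps k;
    series_sgvalP : series_sgval \in in_series_subalg }.

HB.instance Definition _ := [isSub for poly_sgval].
HB.instance Definition _ := [Choice of poly_sgring by <:].
HB.instance Definition _ := [SubChoice_isSubComNzRing of poly_sgring by <:].

HB.instance Definition _ := [isSub for series_sgval].
HB.instance Definition _ := [Choice of series_sgring by <:].
HB.instance Definition _ := [SubChoice_isSubComNzRing of series_sgring by <:].

Definition poly_max : set poly_sgring :=
  ideal_span [set x | exists2 i, i \in a & val x = 'X^i].
Definition series_max : set series_sgring :=
  ideal_span [set x | exists2 i, i \in a & val x = series_of_poly 'X^i].

Lemma semigroup0 : semigroup 0%N.
Proof. by exists (fun=> 0%N); rewrite big1. Qed.

Lemma semigroupD m n : semigroup m -> semigroup n -> semigroup (m + n)%N.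
Proof.
move=> [c ->] [d ->]; exists (fun i => c i + d i)%N.
by rewrite -big_split; apply: eq_bigr => i _; rewrite mulnDl.
Qed.

Lemma semigroup_gen i : uniq a -> i \in a -> semigroup i.
Proof.
move=> Ua ai; exists (fun j => j == i : nat).
by rewrite (bigD1_seq i) //= eqxx mul1n big1 ?addn0 // => j /negPf ->.
Qed.

Lemma poly_subalgXn n : semigroup n -> poly_subalg 'X^n.
Proof.
have [S1 _ SM] := poly_subalg_closed.
have SX p m : poly_subalg p -> poly_subalg (p ^+ m).
  move=> Sp; elim: m => [|m IH]; first by rewrite expr0; apply/set_mem.
  by rewrite exprS; apply/set_mem/SM; apply/mem_set.
case=> c ->; rewrite big_seq.
elim/big_rec: _ => [|i m ai IH]; first by rewrite expr0; apply/set_mem.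
rewrite exprD mulnC exprM; apply/set_mem/SM; apply/mem_set => //.
by apply: SX; apply: sub_gen_smallest; exists i.
Qed.

Lemma poly_subalgP p : uniq a ->
  poly_subalg p <-> forall n, p`_n != 0 -> semigroup n.
Proof.
move=> Ua; have [S1 SL _] := poly_subalg_closed; split; last first.
  move=> supp_p; rewrite -[p]coefK poly_def.
  elim/big_rec: _ => [|i q _ Sq].
    rewrite -(subrr 1) addrC -scaleN1r.
    by apply/set_mem/SL.
  have [-> |pi_neq0] := eqVneq p`_i 0; first by rewrite scale0r add0r.
  apply/set_mem/SL; apply/mem_set; last exact: Sq.
  by apply: poly_subalgXn; apply: supp_p.
apply: (smallest_sub (X := [set p : {poly k} |
  forall n, p`_n != 0 -> semigroup n])) => [|_ [i ai <-] n]; last first.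
  rewrite coefXn; case: (n =P i) => [-> _|_ /eqP //].
  exact: semigroup_gen.
split=> [|c u v /set_mem Su /set_mem Sv|u v /set_mem Su /set_mem Sv];
  apply/mem_set => n.
- by rewrite coef1; case: n => [_|n /eqP //]; apply: semigroup0.
- rewrite coefD coefZ; have [-> |/Sv //] := eqVneq v`_n 0.
  by rewrite addr0 mulf_eq0 negb_or => /andP[_ /Su].
- rewrite coefM => sum_neq0; apply: contrapT => nSn; case/eqP: sum_neq0.
  apply: big1 => i _; apply/eqP; apply: contrapT => /negP.
  rewrite mulf_eq0 negb_or => /andP[/Su Si /Sv Sni]; apply: nSn.
  by rewrite -(subnKC (leq_ord i)); apply: semigroupD.
Qed.

Lemma series_subalgP f : uniq a ->
  series_subalg f <-> forall n, f n != 0 -> semigroup n.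
Proof.
move=> Ua; split=> [Sf n|supp_f n].
  have [p /(poly_subalgP _ Ua) Sp fp] := Sf n.+1.
  by rewrite fp //; apply: Sp.
exists (series_trunc n f) => [|i lt_in]; last by rewrite coef_poly lt_in.
apply/poly_subalgP => // i; rewrite coef_poly.
by case: ifP => [_ /supp_f //|_ /eqP].
Qed.

End SemigroupRings.

Arguments poly_subalg : clear implicits.
Arguments series_subalg : clear implicits.
Arguments poly_max : clear implicits.
Arguments series_max : clear implicits.

(* Main.v *)
Require Import Defs.
From HB Require Import structures.
From mathcomp Require Import all_boot all_order all_algebra.
From mathcomp Require Import boolp classical_sets functions.
From mathcomp Require Import zify ring.

(** Let S be the semigroup, e its least positive element and m the maximal ideal
    {f in R | f(0) = 0}.  The irreducible elements (atoms) of S give a minimal set of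
    monomial generators of m, and the colength of m^n is e n + O(1), so the multiplicity
    of m is e.

    If Z_1(m) is isomorphic to m^(e-1), comparing ranks gives mu(m) = e.

    Conversely, if mu(m) = e the atoms represent every class modulo e exactly once, hence
    S_+ + S_+ is contained in e + S_+ and m = t^e B for the ring B = (m : m).  Reducing
    modulo the atoms, every coordinate of a cycle lies in m, so with x_i = t^e y_i,
    Z_1(m) = {r in m^n | sum r_i y_i = 0} where the row y is unimodular over B.  Elementary
    operations over B reduce y to a row (y_j, h) completed by zeros with
    u y_j + v h = 1, which gives explicit inverse isomorphisms with m^(n-1).  In the
    complete case some y_j is a unit.  In the graded case some y_j is prime to t, and one
    works in the principal ideal ring k[t]/(y_j), lifting to B through multiples of a
    high power of t. *)

Set Implicit Arguments.
Unset Strict Implicit.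
Unset Printing Implicit Defensive.

Import Order.TTheory GRing.Theory Num.Theory.
Local Open Scope classical_set_scope.
Local Open Scope ring_scope.

(** * Power series *)

Section PowerSeries.
Variable k : fieldType.
Implicit Types (f g h : fps k) (T : set nat).

Lemma fpsP f g : (forall n, f n = g n) -> f = g.
Proof. by move=> fg; apply/funext. Qed.

Lemma fps_coef0 n : (0 : fps k) n = 0. Proof. by []. Qed.
Lemma fps_coef1 n : (1 : fps k) n = (n == 0%N)%:R. Proof. exact: coef1. Qed.
Lemma fps_coefD f g n : (f + g) n = f n + g n. Proof. by []. Qed.
Lemma fps_coefN f n : (- f) n = - f n. Proof. by []. Qed.
Lemma fps_coefB f g n : (f - g) n = f n - g n. Proof. by []. Qed.

Lemma fps_coefM f g n : (f * g) n = \sum_(i < n.+1) f i * g (n - i)%N.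
Proof. by []. Qed.

Lemma fps_coef_sum I (r : seq I) (P : pred I) (F : I -> fps k) n :
  (\sum_(i <- r | P i) F i) n = \sum_(i <- r | P i) F i n.
Proof. by elim/big_rec2: _ => // i y1 y2 _ <-. Qed.

Lemma fps_coefM0 f g : (f * g) 0%N = f 0%N * g 0%N.
Proof. by rewrite fps_coefM big_ord1. Qed.

Lemma series_of_poly_is_zmod_morphism : zmod_morphism (@series_of_poly k).
Proof. by move=> p q; apply: fpsP => n; rewrite /series_of_poly coefB. Qed.

Lemma series_of_poly_is_monoid_morphism : monoid_morphism (@series_of_poly k).
Proof.
by split=> // p q; apply: fpsP => n; rewrite fps_coefM /series_of_poly coefM.
Qed.

HB.instance Definition _ :=
  GRing.isZmodMorphism.Build {poly k} (fps k) (@series_of_poly k)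
    series_of_poly_is_zmod_morphism.
HB.instance Definition _ :=
  GRing.isMonoidMorphism.Build {poly k} (fps k) (@series_of_poly k)
    series_of_poly_is_monoid_morphism.

Lemma series_of_poly_inj : injective (@series_of_poly k).
Proof. by move=> p q epq; apply/polyP => i; have := congr1 (fun f : fps k => f i) epq. Qed.

Definition fpsX d : fps k := series_of_poly 'X^d.

Lemma fpsXE d n : fpsX d n = (n == d)%:R.
Proof. by rewrite /fpsX /series_of_poly coefXn. Qed.

Lemma fpsX0 : fpsX 0 = 1.
Proof. by rewrite /fpsX expr0 rmorph1. Qed.

Lemma fpsXn m n : fpsX m ^+ n = fpsX (m * n)%N.
Proof. by rewrite /fpsX exprM -rmorphXn. Qed.

Lemma fps_coefXM d f n : (fpsX d * f) n = if (d <= n)%N then f (n - d)%N else 0.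
Proof.
rewrite fps_coefM; case: leqP => [le_dn|lt_nd].
  have lt_d : (d < n.+1)%N by [].
  rewrite (bigD1 (Ordinal lt_d)) //= fpsXE eqxx mul1r big1 ?addr0 // => i neq_i.
  by rewrite fpsXE (negPf (_ : (i : nat) != d)) ?mul0r.
rewrite big1 // => i _; rewrite fpsXE; case: eqP => [id|_]; last by rewrite mul0r.
by have := ltn_ord i; lia.
Qed.

Definition shift d f : fps k := fun n => f (n + d)%N.

Lemma shiftK d f : (forall i, (i < d)%N -> f i = 0) -> fpsX d * shift d f = f.
Proof.
move=> f0; apply: fpsP => n; rewrite fps_coefXM /shift.
by case: leqP => [le|lt]; rewrite ?subnK // f0.
Qed.

Lemma fpsX_inj d : injective (fun f => fpsX d * f).
Proof.
move=> f g fg; apply: fpsP => n; move/(congr1 (fun h : fps k => h (n + d)%N)): fg.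
by rewrite /= !fps_coefXM leq_addl addnK.
Qed.

Lemma fps_order f : f <> 0 ->
  exists d, exists2 g : fps k, g 0%N != 0 & f = fpsX d * g.
Proof.
move=> fn0; have exn : exists n, f n != 0.
  apply: contrapT => nf; apply: fn0; apply: fpsP => n; apply/eqP/negPn/negP => fn.
  by apply: nf; exists n.
case: (ex_minnP exn) => d fd min_d; exists d; exists (shift d f) => //.
rewrite shiftK // => i lt_id; apply/eqP/negPn/negP => /min_d; lia.
Qed.

Lemma fps_coefX_eq0 f n i : f 0%N = 0 -> (i < n)%N -> (f ^+ n) i = 0.
Proof.
move=> f0; elim: n i => // n IH i lt_in; rewrite exprS fps_coefM big1 // => j _.
have [->|j0] := posnP j; first by rewrite f0 mul0r.
by rewrite IH ?mulr0 //; have := ltn_ord j; lia.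
Qed.

(* The geometric series of [h = 1 - f / f 0] is, coefficientwise, a finite sum. *)
Lemma fps_inv f : f 0%N != 0 -> exists g, f * g = 1.
Proof.
move=> f0; pose c : fps k := series_of_poly (f 0%N)^-1%:P.
pose h : fps k := 1 - c * f.
have h0 : h 0%N = 0.
  by rewrite /h fps_coefB fps_coef1 fps_coefM0 /c /series_of_poly coefC /= mulVf // subrr.
pose G n : fps k := \sum_(i < n) h ^+ i.
pose g : fps k := fun n => G n.+1 n.
have gE n N : (n < N)%N -> g n = G N n.
  move=> lt_nN; rewrite /g /G !fps_coef_sum -(subnKC lt_nN) big_split_ord /=.
  by rewrite [X in _ = _ + X]big1 ?addr0 // => i _; rewrite fps_coefX_eq0 //; lia.
exists (c * g); have -> : f * (c * g) = (1 - h) * g by rewrite /h; ring.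
apply: fpsP => n; have -> : ((1 - h) * g) n = ((1 - h) * G n.+1) n.
  by rewrite !fps_coefM; apply: eq_bigr => i _; rewrite (gE _ n.+1) //; lia.
have -> : (1 - h) * G n.+1 = 1 - h ^+ n.+1.
  by rewrite -opprB mulNr -subrX1 opprB.
by rewrite fps_coefB fps_coefX_eq0 // subr0.
Qed.

Lemma fps_integral f g : f * g = 0 -> f = 0 \/ g = 0.
Proof.
move=> fg0; have [->|/fps_order[d [f' f'0 fE]]] := pselect (f = 0); [by left|right].
have [i f'i] := fps_inv f'0.
apply: (@fpsX_inj d); rewrite /= mulr0 -[g]mul1r -f'i.
by transitivity (i * (f * g)); [rewrite fE; ring|rewrite fg0 mulr0].
Qed.

(** * Series with exponents in a given set *)

Definition supported T f := forall n, f n != 0 -> T n.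

Lemma supportedD T f g : supported T f -> supported T g -> supported T (f + g).
Proof.
move=> Tf Tg n; rewrite fps_coefD; have [-> |/Tf //] := eqVneq (f n) 0.
by rewrite add0r => /Tg.
Qed.

Lemma supportedN T f : supported T f -> supported T (- f).
Proof. by move=> Tf n; rewrite fps_coefN oppr_eq0 => /Tf. Qed.

Lemma supportedM T1 T2 T f g : (forall m n, T1 m -> T2 n -> T (m + n)%N) ->
  supported T1 f -> supported T2 g -> supported T (f * g).
Proof.
move=> T12 Tf Tg n; rewrite fps_coefM => sum_neq0.
apply: contrapT => nTn; case/eqP: sum_neq0; apply: big1 => i _; apply/eqP/negPn/negP.
rewrite mulf_eq0 negb_or => /andP[/Tf Ti /Tg Tni]; apply: nTn.
by have := T12 _ _ Ti Tni; rewrite subnKC // -ltnS.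
Qed.

Lemma supportedX T n : T n -> supported T (fpsX n).
Proof. by move=> Tn i; rewrite fpsXE; case: (i =P n) => [-> //|_]; rewrite eqxx. Qed.

(** By strong induction: for [n] outside [T], every term [f i * g (n - i)] with [i > 0] vanishes
    since [T] is additively closed, so [f 0 * g n = 0]. *)
Lemma supported_div T f g : (forall m n, T m -> T n -> T (m + n)%N) ->
  f 0%N != 0 -> supported T f -> supported T (f * g) -> supported T g.
Proof.
move=> TD f0 Tf Tfg n; elim/ltn_ind: n => n IH gn0; apply: contrapT => nTn.
have : (f * g) n == 0 by apply/negPn/negP => /Tfg.
rewrite fps_coefM big_ord_recl subn0 big1 ?addr0; last first.
  move=> i _; apply/eqP/negPn/negP; rewrite mulf_eq0 negb_or => /andP[/Tf Ti].
  rewrite lift0 => gi; apply: nTn; have := TD _ _ Ti (IH _ _ gi).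
  by rewrite lift0 subnKC ?ltn_ord //; apply; have := ltn_ord i; lia.
by rewrite mulf_eq0 (negPf f0) (negPf gn0).
Qed.

Definition finsupp f := exists N, forall n, (N <= n)%N -> f n = 0.

Lemma finsuppP f : finsupp f <-> exists p, f = series_of_poly p.
Proof.
split=> [[N fN]|[p ->]]; last first.
  by exists (size p) => n le; rewrite /series_of_poly nth_default.
exists (series_trunc N f); apply: fpsP => n; rewrite /series_of_poly coef_poly.
by case: ltnP => // /fN.
Qed.

Lemma finsuppD f g : finsupp f -> finsupp g -> finsupp (f + g).
Proof.
by move=> /finsuppP[p ->] /finsuppP[q ->]; rewrite -rmorphD; apply/finsuppP; exists (p + q).
Qed.

Lemma finsuppM f g : finsupp f -> finsupp g -> finsupp (f * g).
Proof.
by move=> /finsuppP[p ->] /finsuppP[q ->]; rewrite -rmorphM; apply/finsuppP; exists (p * q).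
Qed.

End PowerSeries.
Arguments fpsX {k} d.

(** * Numerical semigroups *)

Section NumericalSemigroup.
Local Open Scope nat_scope.

Lemma submonoid_mul (S : set nat) m n :
  S 0 -> (forall i j, S i -> S j -> S (i + j)) -> S n -> S (m * n).
Proof. by move=> S0 SD Sn; elim: m => // m IH; rewrite mulSn; apply: SD. Qed.

(** Bezout's relation [u i = v g + gcd(i, g)] turns the pair [q], [q + g] in [S] into the pair
    [v (q + g)], [u i + v q], whose difference is [gcd(i, g)]. *)
Lemma submonoid_gcd (S : set nat) (a : seq nat) :
    S 0 -> (forall i j, S i -> S j -> S (i + j)) ->
    (forall i, i \in a -> S i /\ 0 < i) ->
  exists2 q, S q & S (q + \big[gcdn/0]_(i <- a) i).
Proof.
move=> S0 SD; elim: a => [|i a IH] Sa; first by exists 0; rewrite ?big_nil.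
have [j ja|q Sq Sqg] := IH; first by apply: Sa; rewrite inE ja orbT.
have [Si i_gt0] : S i /\ 0 < i by apply: Sa; rewrite inE eqxx.
rewrite big_cons; move: (\big[_/_]_(_ <- _) _) Sqg => g Sqg.
have [u v uv _] := egcdnP g i_gt0; exists (v * (q + g)).
  exact: submonoid_mul.
have -> : v * (q + g) + gcdn i g = u * i + v * q by rewrite uv; lia.
exact: SD (submonoid_mul u S0 SD Si) (submonoid_mul v S0 SD Sq).
Qed.

(** For [q > 0] and [n >= q^2], split [n] into [n mod q] copies of [q + 1] and [n / q - n mod q]
    copies of [q]; the latter number is nonnegative as [n mod q < q <= n / q]. *)
Lemma submonoid_cofinite (S : set nat) q :
    S 0 -> (forall i j, S i -> S j -> S (i + j)) -> S q -> S q.+1 ->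
  exists c, forall n, c <= n -> S n.
Proof.
move=> S0 SD Sq Sq1; have [q0|q_gt0] := posnP q.
  by exists 0 => n _; rewrite -[n]muln1; apply: submonoid_mul => //; rewrite q0 in Sq1.
exists (q * q) => n le_n.
have -> : n = (n %/ q - n %% q) * q + (n %% q) * q.+1.
  have lt_r := ltn_pmod n q_gt0; have le_q : q <= n %/ q by rewrite leq_divRL.
  by rewrite {1}(divn_eq n q); nia.
exact: SD (submonoid_mul _ S0 SD Sq) (submonoid_mul _ S0 SD Sq1).
Qed.

Definition atom (S : set nat) w := [/\ S w, 0 < w &
  forall m n, S m -> S n -> m + n = w -> m = 0 \/ n = 0].

Variable a : seq nat.
Hypothesis a_gen : numerical_generators a.
Local Notation S := (semigroup a).

Lemma generators_uniq : uniq a.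
Proof. by case: a_gen => /(sorted_uniq ltn_trans ltnn). Qed.

Lemma generatorP i : i \in a -> S i /\ 0 < i.
Proof.
move=> ai; split; first exact: (semigroup_gen generators_uniq).
by case: a_gen => _ /allP /(_ _ ai).
Qed.

Lemma semigroup_cofinite : exists c, forall n, c <= n -> S n.
Proof.
have [q Sq Sq1] := submonoid_gcd (semigroup0 a) (@semigroupD a) generatorP.
apply: (submonoid_cofinite (semigroup0 a) (@semigroupD a) Sq).
by case: a_gen Sq1 => _ _ ->; rewrite addn1.
Qed.

Lemma semigroup_factor s : S s -> 0 < s ->
  exists2 i, i \in a & exists2 s', S s' & s = i + s'.
Proof.
case=> c ->; rewrite lt0n => sum_neq0.
have [i ai ci] : exists2 i, i \in a & 0 < c i.
  apply: contrapT => nc; case/eqP: sum_neq0; rewrite big_seq big1 // => i ai.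
  by have [->//|ci] := posnP (c i); case: nc; exists i.
exists i => //; exists (\sum_(j <- a) (c j - (j == i)) * j).
  by exists (fun j => c j - (j == i)).
rewrite !(bigD1_seq i) ?generators_uniq //= eqxx addnA; congr (_ + _); first by nia.
by apply: eq_bigr => j /negPf ->; rewrite subn0.
Qed.

Lemma semigroup_atom_factor s : S s -> 0 < s ->
  exists2 w, atom S w & exists2 s', S s' & s = w + s'.
Proof.
elim/ltn_ind: s => s IH Ss s_gt0.
have [s_atom|not_atom] := pselect (atom S s).
  by exists s => //; exists 0; rewrite ?addn0 //; apply: semigroup0.
have [m [n [Sm Sn mn m_gt0 n_gt0]]] :
    exists m n, [/\ S m, S n, m + n = s, 0 < m & 0 < n].
  apply: contrapT => no; apply: not_atom; split=> // m n Sm Sn mn.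
  have [->|m_gt0] := posnP m; first by left.
  have [->|n_gt0] := posnP n; first by right.
  by case: no; exists m, n.
have [|w w_atom [s' Ss' ms']] := IH m _ Sm m_gt0; first lia.
exists w => //; exists (s' + n); first exact: semigroupD.
by rewrite -mn ms' addnA.
Qed.

Definition atoms : seq nat := [seq w <- a | `[< atom S w >]].

Lemma atoms_uniq : uniq atoms.
Proof. by rewrite filter_uniq // generators_uniq. Qed.

(** An atom is a generator plus an element of the semigroup, which irreducibility forces to be 0; so
    filtering [a] loses no atom. *)
Lemma mem_atoms w : reflect (atom S w) (w \in atoms).
Proof.
rewrite mem_filter; apply: (iffP andP) => [[/asboolP]//|w_atom].
split; first exact/asboolP.
case: (w_atom) => Sw w_gt0 irr; have [i ai [s' Ss' wE]] := semigroup_factor Sw w_gt0.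
have [Si i_gt0] := generatorP ai.
case: (irr i s' Si Ss' (esym wE)) => [i0|s0]; first by rewrite i0 in i_gt0.
by rewrite wE s0 addn0.
Qed.

Lemma semigroup_mul m n : S n -> S (m * n).
Proof. exact: (submonoid_mul _ (semigroup0 a) (@semigroupD a)). Qed.

Lemma semigroup_min : exists e, [/\ S e, 0 < e & forall s, S s -> 0 < s -> e <= s].
Proof.
have [c Sc] := semigroup_cofinite.
have ex : exists s, `[< S s /\ 0 < s >].
  by exists c.+1; apply/asboolP; split=> //; apply: Sc.
case: (ex_minnP ex) => e /asboolP[Se e_gt0] e_min; exists e; split=> // s Ss s_gt0.
by apply: e_min; apply/asboolP.
Qed.

(** A single atom would divide every element of the semigroup, hence two consecutive large integers,
    and would be 1. *)
Lemma size_atoms_gt1 : ~ S 1 -> 1 < size atoms.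
Proof.
move=> nS1; have [c Sc] := semigroup_cofinite.
have [//|//|w /mem_atoms wA _] := @semigroup_atom_factor c.+1; first exact: Sc.
case: (ltnP 1 (size atoms)) => // le1.
have wE v : v \in atoms -> v = w.
  move: wA le1; case: atoms => [|x [|y s]] //; rewrite !inE => /eqP -> _ /eqP -> //.
have S_dvd s : S s -> w %| s.
  elim/ltn_ind: s => s IH Ss; have [->//|s_gt0] := posnP s.
  have [v vA [s' Ss' sE]] := semigroup_atom_factor Ss s_gt0.
  have vw : v = w by apply: wE; apply/mem_atoms.
  have [_ v_gt0 _] := vA; rewrite sE vw dvdn_addr //; apply: IH => //; lia.
have : w %| 1.
  have w_c : w %| c.+1 by apply/S_dvd/Sc.
  by rewrite -(dvdn_addr 1 w_c); apply/S_dvd/Sc; lia.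
rewrite dvdn1 => /eqP w1; case: nS1; rewrite -w1.
by case/mem_atoms: wA.
Qed.

(* Distinct atoms are incongruent modulo [e], so [e] atoms meet every residue class. *)
Lemma minimal_multiplicity_sub e s s' :
    S e -> 0 < e -> size atoms = e -> S s -> 0 < s -> S s' -> 0 < s' ->
  exists2 t, S t & 0 < t /\ s + s' = t + e.
Proof.
move=> Se e_gt0 sizeA Ss s_gt0 Ss' s'_gt0.
have irr v m : atom S v -> S m -> 0 < m -> atom S (v + m) -> False.
  move=> [Sv v_gt0 _] Sm m_gt0 [_ _ irr]; have := irr v m Sv Sm erefl; lia.
(* If [v < w] are congruent atoms, [w = v + q e] splits into positive elements of the semigroup. *)
have mod_inj : {in atoms &, injective (modn^~ e)}.
  move=> v w; wlog le_vw : v w / v <= w => [wlg|/mem_atoms vA /mem_atoms wA mod_vw].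
    move=> vA wA mod_vw; case: (leqP v w) => [/wlg|/ltnW /wlg]; first exact.
    by move=> wlg'; rewrite (wlg' wA vA).
  have [//|lt_vw] := eqVneq v w; have /dvdnP[q qE] : e %| w - v.
    by rewrite -eqn_mod_dvd //; apply/eqP.
  case: (@irr v (q * e) vA); first exact: semigroup_mul.
    by rewrite -qE; lia.
  by rewrite -qE subnKC.
have : (s + s') %% e \in map (modn^~ e) atoms.
  have uniq_mod : uniq (map (modn^~ e) atoms) by rewrite map_inj_in_uniq ?atoms_uniq.
  have sub_mod : {subset map (modn^~ e) atoms <= iota 0 e}.
    by move=> _ /mapP[v _ ->]; rewrite mem_iota ltn_pmod.
  have [|_ ->] := uniq_min_size uniq_mod sub_mod; last by rewrite mem_iota ltn_pmod.
  by rewrite size_map size_iota sizeA.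
case/mapP => w /mem_atoms wA mod_w.
(* If the atom [w] in the class of [s + s'] is at least [s + s'], then [w = s + (s' + q e)] is
   decomposable. Otherwise [s + s' = w + q e] with [q > 0], and [t = w + (q - 1) e]. *)
have [le_w|lt_w] := leqP (s + s') w.
  have /dvdnP[q qE] : e %| w - (s + s') by rewrite -eqn_mod_dvd // mod_w.
  have Sq : S (s' + q * e) by apply: semigroupD Ss' (semigroup_mul _ Se).
  by case: wA => _ _ /(_ s (s' + q * e) Ss Sq) irr_w; case: irr_w; lia.
have /dvdnP[q qE] : e %| s + s' - w by rewrite -eqn_mod_dvd ?mod_w // ltnW.
case: (wA) => Sw w_gt0 _; exists (w + q.-1 * e).
  exact: semigroupD Sw (semigroup_mul _ Se).
by split; [rewrite addn_gt0 w_gt0|case: q qE => [|q] /=; rewrite ?mul0n ?mulSn; lia].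
Qed.

End NumericalSemigroup.

(** * Ranks of submodules over a domain *)

Section ModulesOverADomain.
Variable R : comNzRingType.

Lemma submodule_lincomb (V : lmodType R) (A : set V) m (c : 'I_m -> R) (v : 'I_m -> V) :
  submodule A -> (forall i, A (v i)) -> A (\sum_(i < m) c i *: v i).
Proof.
move=> [A0 AL] Av; elim/big_rec: _ => [//|i u _ Au]; exact: AL.
Qed.

Lemma submodule_map_lincomb (U V : lmodType R) (A : set U) (f : U -> V) m
    (c : 'I_m -> R) (v : 'I_m -> U) :
    submodule A -> (forall (a : R) u w, A u -> A w -> f (a *: u + w) = a *: f u + f w) ->
    (forall i, A (v i)) ->
  f (\sum_(i < m) c i *: v i) = \sum_(i < m) c i *: f (v i).
Proof.
move=> A_sub f_lin Av; have f0 : f 0 = 0.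
  case: A_sub => A0 _; have /eqP := f_lin 1 _ _ A0 A0.
  by rewrite !scale1r addr0 eq_sym -subr_eq0 addrK => /eqP.
suff [] : A (\sum_(i < m) c i *: v i) /\
    f (\sum_(i < m) c i *: v i) = \sum_(i < m) c i *: f (v i) by [].
elim/big_rec2: _ => [|i u w _ [Aw fw]]; first by case: A_sub.
by split; [case: A_sub => _; apply|rewrite f_lin ?fw].
Qed.

Lemma Z1_submodule n (x : 'I_n -> R) : submodule (Z1 x).
Proof.
split=> [|c u v Zu Zv]; rewrite /Z1 /=; first by rewrite big1 // => i _; rewrite mxE mul0r.
under eq_bigr do rewrite !mxE mulrDl -mulrA.
by rewrite big_split -mulr_sumr /= Zu Zv mulr0 addr0.
Qed.

Lemma ideal_spanP n (x : 'I_n -> R) y :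
  ideal_span (range x) y <-> exists r : 'I_n -> R, y = \sum_(i < n) r i * x i.
Proof.
split=> [|[r ->]].
  apply: (smallest_sub (X := [set y | exists r : 'I_n -> R, y = \sum_(i < n) r i * x i])).
    split=> [|c u v [r ->] [s ->]].
      by exists (fun=> 0); rewrite big1 // => i _; rewrite mul0r.
    exists (fun i => c * r i + s i); rewrite -[_ *: _]/(c * _) mulr_sumr -big_split /=.
    by apply: eq_bigr => i _; rewrite mulrDl mulrA.
  move=> _ [i _ <-]; exists (fun j => (j == i)%:R).
  rewrite (bigD1 i) //= eqxx mul1r big1 ?addr0 // => j /negPf ->.
  by rewrite mul0r.
move=> J [[J0 JL] xJ]; elim/big_rec: _ => [//|i u _ Ju].
by apply: JL => //; apply: xJ; exists i.
Qed.

Lemma ideal_span_ideal (G : set R) : ideal (ideal_span G).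
Proof.
split=> [J [[]]//|c u v Gu Gv J GJ].
by have [[_ JL] _] := GJ; apply: JL; [apply: Gu|apply: Gv].
Qed.

Lemma ideal_mul (I : set R) r y : ideal I -> I y -> I (r * y).
Proof. by move=> [I0 IL] Iy; have := IL r y 0 Iy I0; rewrite addr0. Qed.

Lemma idealD (I : set R) y z : ideal I -> I y -> I z -> I (y + z).
Proof. by move=> [I0 IL] Iy Iz; have := IL 1 y z Iy Iz; rewrite scale1r. Qed.

Lemma ideal_sum (I : set R) J (r : seq J) (P : pred J) (F : J -> R) :
  ideal I -> (forall j, P j -> I (F j)) -> I (\sum_(j <- r | P j) F j).
Proof.
move=> I_id IF; elim/big_rec: _ => [|j u Pj Iu]; first by case: I_id.
exact: idealD (IF j Pj) Iu.
Qed.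

Lemma chain_extend (M : lmodType R) (W V V' : set M) l :
  submodule_chain W V l -> submodule V' -> V `<` V' -> submodule_chain W V' l.+1.
Proof.
move=> [c [c0 cl c_sub c_lt]] V'_sub ltV; exists (fun i => if (i <= l)%N then c i else V').
split=> [|||i]; rewrite ?ltnn //.
- by move=> i _; case: ifP => // le_il; apply: c_sub.
- rewrite ltnS => le_il; rewrite le_il; case: ltnP => [|le_li]; first exact: c_lt.
  by have -> : i = l; [apply/eqP; rewrite eqn_leq le_il|rewrite cl].
Qed.

Hypothesis R_integral : forall x y : R, x * y = 0 -> x = 0 \/ y = 0.

(* Fraction-free Gaussian elimination. *)
Lemma exists_left_kernel p q (A : 'M[R]_(p, q)) : (q < p)%N ->
  exists2 c : 'rV[R]_p, c != 0 & c *m A = 0.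
Proof.
elim: q p A => [|q IH] [|p] // A lt_qp.
  exists (const_mx 1); last exact: thinmx0.
  by apply/eqP => /rowP/(_ ord0)/eqP; rewrite !mxE oner_eq0.
have [[i0 Ai0]|A0] := pselect (exists i, A i ord0 <> 0); last first.
  have [c c0 cA] := IH _ (col' ord0 A) (ltnW lt_qp); exists c => //.
  apply/rowP => j; have := cA; have [j' ->|->] := unliftP ord0 j => /rowP.
    move=> /(_ j'); rewrite !mxE => {2}<-; apply: eq_bigr => i _.
    by rewrite [X in _ = _ * X]mxE.
  move=> _; rewrite !mxE big1 // => i _; have [->|Ai] := pselect (A i ord0 = 0).
    exact: mulr0.
  by case: A0; exists i.
pose A' : 'M[R]_(p, q) := \matrix_(i, j) (A i0 ord0 * A (lift i0 i) (lift ord0 j) -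
   A (lift i0 i) ord0 * A i0 (lift ord0 j)).
have [c' c'0 cA'] := IH _ A' lt_qp.
pose c : 'rV[R]_p.+1 := \row_i oapp (fun i' => A i0 ord0 * c' ord0 i')
  (- \sum_i' c' ord0 i' * A (lift i0 i') ord0) (unlift i0 i).
exists c.
  apply: contra_neq c'0 => /rowP c0; apply/rowP => i; rewrite mxE.
  by have := c0 (lift i0 i); rewrite !mxE liftK /= => /R_integral[].
apply/rowP => j; rewrite !mxE (bigD1_ord i0) //= !mxE unlift_none /=.
rewrite mulNr mulr_suml.
under [X in _ + X]eq_bigr do rewrite mxE liftK /=.
rewrite addrC -sumrB.
have [j' ->|->] := unliftP ord0 j; last by rewrite big1 // => i _ /=; ring.
have /rowP/(_ j') := cA'; rewrite !mxE => {2}<-; apply: eq_bigr => i _.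
rewrite [X in _ = _ * X]mxE /=; ring.
Qed.

(** [Z1 x] has rank [n], as its defining relation has a nonzero coefficient [x j]; [q] copies of a
    nonzero ideal have rank [q]. Each strict inequality is refuted by transporting a linear
    dependency along [f]. *)
Lemma Z1_iso_rank n (x : 'I_n.+1 -> R) j (I : set R) d q :
    x j <> 0 -> ideal I -> I d -> d <> 0 -> submodule_iso (Z1 x) (ideal_dsum I q) ->
  n = q.
Proof.
move=> xj0 [I0 IL] Id d0 [f [f_fun f_inj f_surj] f_lin].
have Zx := Z1_submodule x.
have f0 : f 0 = 0.
  have Z0 : Z1 x 0 by case: Zx.
  have /eqP := f_lin 1 _ _ Z0 Z0.
  by rewrite !scale1r addr0 eq_sym -subr_eq0 addrK => /eqP.
have f_eq0 w : Z1 x w -> f w = 0 -> w = 0.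
  by move=> Zw fw; apply: f_inj; rewrite ?fw ?f0 // inE //; case: Zx.
apply/eqP; rewrite eqn_leq; apply/andP; split; rewrite leqNgt; apply/negP => lt.
  (* The Koszul syzygies [x_j e_i - x_i e_j] are independent, but for [q < n] their images are
     dependent, contrary to injectivity of [f]. *)
  pose z (i : 'I_n) : 'rV[R]_n.+1 :=
    x j *: delta_mx 0 (lift j i) - x (lift j i) *: delta_mx 0 j.
  have Zz i : Z1 x (z i).
    rewrite /Z1 /= (bigD1_ord j) //= (bigD1 i) //= big1 ?addr0 => [|i' ne].
      by rewrite !mxE !eqxx (negPf (neq_lift j i)) eq_sym (negPf (neq_lift j i)) /=; ring.
    rewrite /z !mxE eqxx (inj_eq lift_inj) (negPf ne) eq_sym (negPf (neq_lift j i')) /=; ring.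
  have [c c0 cA] := exists_left_kernel (\matrix_i f (z i)) lt.
  have w0 : \sum_i c ord0 i *: z i = 0.
    apply: f_eq0; first exact: submodule_lincomb.
    rewrite (submodule_map_lincomb _ Zx f_lin Zz) -[RHS]cA mulmx_sum_row.
    by apply: eq_bigr => i _; rewrite rowK.
  case/eqP: c0; apply/rowP => i; rewrite mxE.
  move/rowP/(_ (lift j i)): w0; rewrite mxE summxE (bigD1 i) //= big1 ?addr0 => [|i' ne].
    rewrite !mxE !eqxx eq_sym (negPf (neq_lift j i)) mulr0 subr0 mulr1.
    by case/R_integral.
  rewrite !mxE eqxx (inj_eq lift_inj) eq_sym (negPf ne) eq_sym (negPf (neq_lift j i)) /=; ring.
(* For [n < q], combine preimages of the vectors [d e_i] so that all coordinates other than [j]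
   vanish. Being a cycle, the combination also vanishes at [j], and applying [f] gives
   [c_i d = 0]. *)
have p_ex (i : 'I_q) : exists p, Z1 x p /\ f p = d *: delta_mx 0 i.
  have [i'|p Zp fp] := f_surj (d *: delta_mx 0 i); last by exists p.
  by rewrite !mxE; case: (_ && _); rewrite ?mulr1 ?mulr0.
have [p pP] := choice p_ex.
have Zp i : Z1 x (p i) by case: (pP i).
have [c c0 cA] := exists_left_kernel (\matrix_(i, i') p i ord0 (lift j i')) lt.
have Zw : Z1 x (\sum_i c ord0 i *: p i) by exact: submodule_lincomb.
have w0 : \sum_i c ord0 i *: p i = 0.
  move: (Zw); set w := \sum_i _ => Zw'; have w_lift i : w ord0 (lift j i) = 0.
    move/rowP/(_ i): cA; rewrite !mxE => cAi; rewrite -[RHS]cAi summxE.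
    by apply: eq_bigr => i' _; rewrite !mxE.
  move: Zw'; rewrite /Z1 /= (bigD1_ord j) //= big1 ?addr0 => [|i _].
    case/R_integral => // wj; apply/rowP => i.
    by have [i' ->|->] := unliftP j i; rewrite mxE.
  by rewrite w_lift mul0r.
have := submodule_map_lincomb (fun i => c ord0 i) Zx f_lin Zp; rewrite w0 f0 => fw.
case/eqP: c0; apply/rowP => i; rewrite mxE.
move/rowP/(_ i): fw; rewrite mxE summxE (bigD1 i) //= big1 ?addr0 => [|i' ne].
  by case: (pP i) => _ ->; rewrite !mxE !eqxx mulr1 => /esym/R_integral[].
by case: (pP i') => _ ->; rewrite !mxE eqxx eq_sym (negPf ne) !mulr0.
Qed.

End ModulesOverADomain.

(** * Polynomials of linear growth *)

Lemma poly_linear_growth (P : {poly rat}) (e C N : nat) :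
    (forall n, (N <= n)%N -> exists2 l : nat, P.[n%:R] = l%:R &
       (e * n <= l + C)%N /\ (l <= e * n + C)%N) ->
  exists c, P = e%:R *: 'X + c%:P.
Proof.
move=> Pn; pose Q i : {poly rat} := P - e%:R *: 'X + (C%:R - i%:R)%:P.
pose T := \prod_(i < (C + C).+1) Q i.
have T0 : T = 0.
  apply/eqP/negPn/negP => Tn0.
  pose rs : seq rat := [seq n%:R | n <- iota N (size T)].
  have roots_T : all (root T) rs.
    apply/allP => r /mapP[n]; rewrite mem_iota => /andP[le_Nn _] ->.
    have [l Pl [le1 le2]] := Pn n le_Nn.
    have lt_i : (l + C - e * n < (C + C).+1)%N by lia.
    rewrite rootE /T (bigD1 (Ordinal lt_i)) //= hornerM /Q.
    rewrite !hornerD hornerN hornerZ hornerX hornerC Pl.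
    rewrite natrB // natrD natrM; apply/eqP; ring.
  have uniq_rs : uniq rs.
    by rewrite map_inj_uniq ?iota_uniq // => m n /eqP; rewrite eqr_nat => /eqP.
  by have := max_poly_roots Tn0 roots_T uniq_rs; rewrite size_map size_iota ltnn.
have /eqP := T0; rewrite /T => /prodf_eq0[i _ /eqP Qi].
exists (i%:R - C%:R); rewrite rmorphB /= !polyC_natr -[P]subr0 -Qi /Q /=; ring.
Qed.

Lemma linear_growth_multiplicity (e : nat) (c : rat) : (0 < e)%N ->
  let P := e%:R *: 'X + c%:P in ((size P).-1)`!%:R * lead_coef P = e%:R.
Proof.
move=> e_gt0 P; have e0 : (e%:R : rat) != 0 by rewrite pnatr_eq0 -lt0n.
have PE : P = e%:R%:P * 'X + c%:P by rewrite mul_polyC.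
have sizeP : size P = 2.
  by rewrite PE size_MXaddC polyC_eq0 (negPf e0) /= size_polyC e0.
by rewrite lead_coefE sizeP PE coefD coefMX !coefC /= addr0 mul1r.
Qed.

(** * Unimodular rows *)

Section StableRange.
Variable k : fieldType.
Implicit Types (f p q r : {poly k}).

Lemma irreducible_factor p : (1 < size p)%N -> exists2 d, irreducible_poly d & d %| p.
Proof.
elim: (size p) {-2}p (leqnn (size p)) => [|s IH] {}p; first by case: size.
move=> le_ps p_gt1; have [p_irr|] := pselect (irreducible_poly p); first by exists p.
move=> p_red; have [q [q1 q_p q_neq]] : exists q, [/\ size q != 1%N, q %| p & ~~ (q %= p)].
  apply: contrapT => no; apply: p_red; split=> // q q1 q_p.
  by apply: contrapT => /negP ne; apply: no; exists q.
have p0 : p != 0 by rewrite -size_poly_gt0; lia.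
have q0 : size q != 0%N.
  by rewrite size_poly_eq0; apply: contraNneq p0 => q0; rewrite q0 dvd0p in q_p.
have lt_qp : (size q < size p)%N.
  rewrite ltn_neqAle (dvdp_leq p0 q_p) andbT.
  by apply: contra q_neq => eq_size; rewrite -(dvdp_size_eqp q_p).
have [||d d_irr d_q] := IH q; [lia|lia|].
by exists d => //; apply: dvdp_trans q_p.
Qed.

(* With [c] the largest divisor of [f] prime to [a], every irreducible factor of [f]
   divides exactly one of [a] and [c]. *)
Lemma avoid_common_factors f p q : f != 0 ->
  exists c, forall d, irreducible_poly d -> d %| f -> d %| p + c * q ->
    d %| p /\ d %| q.
Proof.
move=> f0; case: (gdcopP p f) => c c_f; rewrite (negPf f0) orbF => c_p c_max.
exists c => d d_irr d_f d_sum.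
have [d_p|d_np] := boolP (d %| p).
  split=> //; move: d_sum; rewrite dvdp_addr // Gauss_dvdpr //.
  by rewrite coprimep_sym; apply: coprimep_dvdl d_p c_p.
have d_c : d %| c by apply: c_max => //; rewrite irreducible_poly_coprime.
by move: d_sum; rewrite dvdp_addl ?(negPf d_np) // dvdp_mulr.
Qed.

(** Entries are folded in one at a time by [avoid_common_factors]. If [f] and the [p i] have no
    common factor, the combination is then prime to [f]. *)
Lemma reduce_unimodular_row f m (p : nat -> {poly k}) : f != 0 ->
  exists2 c : nat -> {poly k}, c 0%N = 1 &
    forall d, irreducible_poly d -> d %| f -> d %| \sum_(i < m.+1) c i * p i ->
      forall i, (i <= m)%N -> d %| p i.
Proof.
move=> f0; elim: m => [|m [c c0 cP]].
  by exists (fun=> 1) => // d _ _; rewrite big_ord1 mul1r => d_p [].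
have [b bP] := avoid_common_factors (\sum_(i < m.+1) c i * p i) (p m.+1) f0.
exists (fun i => if (i <= m)%N then c i else b) => // d d_irr d_f.
rewrite big_ord_recr /= ltnn.
under eq_bigr => i _ do rewrite -ltnS ltn_ord.
move=> /(bP d d_irr d_f)[d_sum d_p] i; rewrite leq_eqVlt => /predU1P[->//|].
exact: cP.
Qed.

(* [pi], a multiple of ['X^s] congruent to [1] modulo [q j], makes the coefficients
   divisible by ['X^s] without changing them modulo [q j]. *)
Lemma unimodular_row_reduction m s (q r : 'I_m.+2 -> {poly k}) j :
    (q j)`_0 != 0 -> \sum_(i < m.+2) r i * q i = 1 ->
  exists (c : 'I_m.+1 -> {poly k}) u v,
    [/\ c ord0 = 1, forall i, i != ord0 -> 'X^s %| c i, 'X^s %| v &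
        u * q j + v * (\sum_(i < m.+1) c i * q (lift j i)) = 1].
Proof.
move=> qj0 rq; have qj_neq0 : q j != 0 by apply: contraNneq qj0 => ->; rewrite coef0.
pose p i := q (lift j (inord i)).
have [c0 c00 c0P] := reduce_unimodular_row m p qj_neq0.
pose h := \sum_(i < m.+1) c0 i * q (lift j i).
have hE : h = \sum_(i < m.+1) c0 i * p i.
  by apply: eq_bigr => i _; rewrite /p inord_val.
(* A common irreducible factor of [q j] and [h] would divide every entry of the row, hence 1. *)
have /Bezout_eq1_coprimepP[[u0 v0] /= uv] : coprimep (q j) h.
  apply: contrapT => /negP ncop.
  have [|d d_irr d_gcd] := @irreducible_factor (gcdp (q j) h).
    move: ncop; rewrite /coprimep => ncop.
    have : gcdp (q j) h != 0 by rewrite gcdp_eq0 (negPf qj_neq0).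
    by rewrite -size_poly_gt0; case: (size _) ncop => [|[|]].
  move: d_gcd; rewrite dvdp_gcd hE => /andP[d_q /(c0P d d_irr d_q) d_p].
  have : d %| 1.
    rewrite -rq; apply: (big_ind (fun x => d %| x)) => [|x y|i _].
    - exact: dvdp0.
    - exact: dvdp_add.
    apply: dvdp_mull; have [i' ->|->//] := unliftP j i.
    by rewrite -(inord_val i'); apply: d_p; rewrite -ltnS.
  by rewrite dvdp1; case: d_irr => /gtn_eqF ->.
have /Bezout_eq1_coprimepP[[a b] /= ab] : coprimep (q j) 'X^s.
  by rewrite coprimep_expr // coprimepX rootE horner_coef0.
pose pi := b * 'X^s.
pose w := \sum_(i < m.+1 | i != ord0) c0 i * q (lift j i).
(* As [1 - pi = a q_j], the new combination is [h - a q_j w]. Multiplying [u0 q_j + v0 h = 1] by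
   [pi] and adding [a q_j = 1 - pi] determines [u]. *)
exists (fun i => if i == ord0 then 1 else pi * c0 i).
exists (a + pi * u0 + pi * v0 * a * w), (pi * v0).
split=> // [i /negPf ->||].
- by rewrite dvdp_mulr // dvdp_mulIr.
- by rewrite dvdp_mulr // dvdp_mulIr.
rewrite (bigD1 ord0) //= mul1r.
under eq_bigr => i /negPf -> do rewrite -mulrA.
rewrite -mulr_sumr -/w.
have hw : h = q (lift j ord0) + w by rewrite /h (bigD1 ord0) //= c00 mul1r.
have -> : q (lift j ord0) = h - w by rewrite hw addrK.
have piE : pi = 1 - a * q j by rewrite -ab /pi; ring.
have vh : v0 * h = 1 - u0 * q j by rewrite -uv; ring.
transitivity (a * q j + pi * u0 * q j + pi * (v0 * h) + pi * v0 * w * (a * q j - 1 + pi)).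
  by ring.
rewrite vh piE; ring.
Qed.

End StableRange.

(* [fin] tells whether series are required to be polynomials: it is [True] for the
   graded rings and [False] for the complete ones. *)
Section Admissible.
Variables (k : fieldType) (fin : Prop).
Implicit Types (f g : fps k) (T : set nat).

Definition admissible T f := supported T f /\ (fin -> finsupp f).

Lemma admissibleD T f g : admissible T f -> admissible T g -> admissible T (f + g).
Proof.
move=> [Tf ff] [Tg fg]; split; first exact: supportedD.
by move=> h; apply: finsuppD; [apply: ff|apply: fg].
Qed.

Lemma admissibleM T1 T2 T f g : (forall m n, T1 m -> T2 n -> T (m + n)%N) ->
  admissible T1 f -> admissible T2 g -> admissible T (f * g).
Proof.
move=> T12 [Tf ff] [Tg fg]; split; first exact: supportedM T12 Tf Tg.
by move=> h; apply: finsuppM; [apply: ff|apply: fg].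
Qed.

Lemma admissible0 T : admissible T 0.
Proof. by split=> [n|_]; [rewrite fps_coef0 eqxx|exists 0%N]. Qed.

Lemma admissibleX T n : T n -> admissible T (fpsX n).
Proof. by split; [apply: supportedX|move=> _; apply/finsuppP; eexists]. Qed.

Lemma admissible_sum T I (r : seq I) (P : pred I) (F : I -> fps k) :
  (forall i, P i -> admissible T (F i)) -> admissible T (\sum_(i <- r | P i) F i).
Proof.
move=> TF; elim/big_rec: _ => [|i f Pi Tf]; first exact: admissible0.
exact: admissibleD (TF i Pi) Tf.
Qed.

(* Unimodular rows of length at least 2 over the ring of [T]-supported series can be
   reduced to [1] by elementary operations; [c], [u], [v] record them. *)
Definition rows_reducible := forall (T : set nat) s, T 0%N ->
  (forall m n, T m -> T n -> T (m + n)%N) -> (forall n, (s <= n)%N -> T n) ->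
  forall p (y r : 'I_p.+2 -> fps k), (forall i, admissible T (y i)) ->
  (forall i, admissible T (r i)) -> \sum_i r i * y i = 1 ->
  exists j (c : 'I_p.+1 -> fps k) u v,
    [/\ c ord0 = 1, forall i, admissible T (c i), admissible T u, admissible T v &
        u * y j + v * \sum_i c i * y (lift j i) = 1].

Lemma unimodular_row_unit n (y r : 'I_n -> fps k) :
  \sum_i r i * y i = 1 -> exists j, y j 0%N != 0.
Proof.
move=> ry1; apply: contrapT => no; have /eqP : (1 : fps k) 0%N = 0; last first.
  by rewrite fps_coef1 oner_eq0.
rewrite -ry1 fps_coef_sum big1 // => i _; rewrite fps_coefM0.
have [->|yi] := eqVneq (y i 0%N) 0; first by rewrite mulr0.
by case: no; exists i.
Qed.

(** Some [y j] is a unit: take [u] its inverse and [v = 0]. By [supported_div] the inverse has its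
    support in [T]. *)
Lemma series_rows_reducible : ~ fin -> rows_reducible.
Proof.
move=> nfin T s T0 TD Ts p y r Ty _ /unimodular_row_unit[j yj0].
have [u yu1] := fps_inv yj0.
have T1 : admissible T 1 by rewrite -fpsX0; apply: admissibleX.
exists j, (fun i => (i == ord0)%:R), u, 0; split=> // [i|||].
- by case: (i == ord0); [exact: T1|exact: admissible0].
- split=> //; apply: supported_div TD yj0 _ _; first by case: (Ty j).
  by rewrite yu1; case: T1.
- exact: admissible0.
- by rewrite mul0r addr0 mulrC.
Qed.

(** Multiples of ['X^s] are supported in [T], which settles [v] and the coefficients [c i]. For [u],
    the product [u y_j = 1 - v h] is supported in [T] and [y_j] has a nonzero constant term, so
    [supported_div] applies. *)
Lemma poly_rows_reducible : fin -> rows_reducible.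
Proof.
move=> hfin T s T0 TD Ts p y r Ty Tr ry1.
have /choice[q qE] : forall i, exists q, y i = series_of_poly q.
  by move=> i; apply/finsuppP; have [_] := Ty i; apply.
have /choice[b bE] : forall i, exists b, r i = series_of_poly b.
  by move=> i; apply/finsuppP; have [_] := Tr i; apply.
have [j yj0] := unimodular_row_unit ry1.
have bq1 : \sum_i b i * q i = 1.
  apply: series_of_poly_inj; rewrite rmorph_sum rmorph1 -ry1; apply: eq_bigr => i _ /=.
  by rewrite rmorphM qE bE.
have qj0 : (q j)`_0 != 0 by move: yj0; rewrite qE.
have [c [u [v [c0 cX vX uv]]]] := unimodular_row_reduction s qj0 bq1.
have T1 : admissible T 1 by rewrite -fpsX0; apply: admissibleX.
have TX (d : {poly k}) : 'X^s %| d -> admissible T (series_of_poly d).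
  move=> /dvdpP[d' ->]; split=> [n|_]; last by apply/finsuppP; eexists.
  rewrite rmorphM mulrC fps_coefXM; case: leqP => [le _|]; first exact: Ts.
  by rewrite eqxx.
have Tc i : admissible T (series_of_poly (c i)).
  by have [->|ne] := eqVneq i ord0; [rewrite c0 rmorph1|apply/TX/cX].
have Tv := TX v vX.
have uvE : series_of_poly u * y j +
    series_of_poly v * \sum_i series_of_poly (c i) * y (lift j i) = 1.
  rewrite -[RHS](rmorph1 (@series_of_poly k)) -uv rmorphD !rmorphM rmorph_sum /= qE.
  by congr (_ + _ * _); apply: eq_bigr => i _; rewrite rmorphM qE.
have Tsum : admissible T (series_of_poly v * \sum_i series_of_poly (c i) * y (lift j i)).
  apply: (admissibleM TD Tv); apply: admissible_sum => i _.
  exact: admissibleM TD (Tc i) (Ty _).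
exists j, (fun i => series_of_poly (c i)), (series_of_poly u), (series_of_poly v).
split=> //; first by rewrite c0 rmorph1.
split=> [|_]; last by apply/finsuppP; eexists.
apply: supported_div TD yj0 _ _; first by case: (Ty j).
have -> : y j * series_of_poly u =
    1 - series_of_poly v * \sum_i series_of_poly (c i) * y (lift j i).
  by rewrite -uvE; ring.
apply: supportedD; first by case: T1.
by apply: supportedN; case: Tsum.
Qed.

End Admissible.

(** * Numerical semigroup rings *)

Section SemigroupRing.
Variables (k : fieldType) (a : seq nat) (fin : Prop).
Variables (R : comNzRingType) (cf : {rmorphism R -> fps k}).
Hypothesis a_gen : numerical_generators a.
Local Notation S := (semigroup a).
Local Notation N := (size (atoms a)).

Hypothesis cf_inj : injective cf.
Hypothesis cfP : forall f, (exists r, cf r = f) <-> admissible fin S f.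

(** [R] is seen only through its expansion [cf] in powers of [t], so that both rings are treated at
    once; this ideal specializes to [poly_max] and [series_max]. *)
Definition irrelevant_ideal : set R :=
  ideal_span [set x | exists2 i, i \in a & cf x = fpsX i].
Local Notation m := irrelevant_ideal.

Lemma cf_supp r : supported S (cf r).
Proof. by have [|] := (cfP (cf r)).1; first by exists r. Qed.

Lemma cf_fin r : fin -> finsupp (cf r).
Proof. by have [|_] := (cfP (cf r)).1; first by exists r. Qed.

Lemma sgring_integral (x y : R) : x * y = 0 -> x = 0 \/ y = 0.
Proof.
move=> xy0; have : cf x * cf y = 0 by rewrite -rmorphM xy0 rmorph0.
by case/fps_integral => c0; [left|right]; apply: cf_inj; rewrite rmorph0.
Qed.

Lemma exists_monomial n : S n -> exists r, cf r = fpsX n.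
Proof. by move=> Sn; apply/cfP/admissibleX. Qed.

Lemma atom_mem (i : 'I_N) : atom S (nth 0%N (atoms a) i).
Proof. exact/(mem_atoms a_gen)/mem_nth. Qed.

Lemma exists_atom_family :
  exists X : 'I_N -> R, forall i, cf (X i) = fpsX (nth 0%N (atoms a) i).
Proof.
have [X XE] := choice (fun i : 'I_N =>
  exists_monomial (let: And3 Sw _ _ := atom_mem i in Sw)).
by exists X.
Qed.

(** [W] picks for each positive exponent in [S] an atom that can be split off, and [g i] collects
    the terms of [r] assigned to atom [i], divided by [X i]. This is done coefficientwise, so it
    also covers infinite series. *)
Lemma sgring_decomposition (X : 'I_N -> R) r :
    (forall i, cf (X i) = fpsX (nth 0%N (atoms a) i)) -> cf r 0%N = 0 ->
  exists g : 'I_N -> R, r = \sum_(i < N) g i * X i.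
Proof.
move=> XE r0; have : forall s, exists i : nat, S s -> (0 < s)%N ->
    (i < N)%N /\ exists2 s', S s' & s = (nth 0%N (atoms a) i + s')%N.
  move=> s; have [[Ss s_gt0]|no] := pselect (S s /\ (0 < s)%N); last first.
    by exists 0%N => Ss s_gt0; case: no.
  have [w wA [s' Ss' ->]] := semigroup_atom_factor Ss s_gt0.
  exists (index w (atoms a)) => _ _; have /(mem_atoms a_gen) w_in := wA.
  by rewrite index_mem nth_index //; split=> //; exists s'.
case/choice => W WP.
pose g (i : 'I_N) : fps k := fun n =>
  if W (n + nth 0%N (atoms a) i)%N == i then cf r (n + nth 0%N (atoms a) i)%N else 0.
have g_ex i : exists gi, cf gi = g i.
  have [_ w_gt0 _] := atom_mem i.
  apply/cfP; split=> [n|/(cf_fin r)[M rM]]; rewrite /g; last first.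
    by exists M => n le; case: eqP => // _; apply: rM; lia.
  case: (W _ =P _) => [Wi /cf_supp Sn|_]; last by rewrite eqxx.
  have [|_ [s' Ss']] := WP _ Sn; first by lia.
  by rewrite Wi addnC => /addnI ->.
have [G GE] := choice g_ex; exists G; apply: cf_inj; apply: fpsP => n.
rewrite rmorph_sum fps_coef_sum /=.
under eq_bigr => i _ do rewrite rmorphM GE XE mulrC fps_coefXM.
have [rn0|rn0] := eqVneq (cf r n) 0.
  rewrite rn0 big1 // => i _; case: ifP => // le; rewrite /g subnK // rn0.
  by case: ifP.
have n_gt0 : (0 < n)%N by case: n rn0 => //; rewrite r0 eqxx.
have [lt_W [s' Ss' nE]] := WP n (cf_supp rn0) n_gt0.
rewrite (bigD1 (Ordinal lt_W)) //= big1 ?addr0 => [|i ne].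
  have le_n : (nth 0%N (atoms a) (W n) <= n)%N by rewrite {2}nE leq_addr.
  by rewrite le_n /g /= subnK // eqxx.
case: ifP => // le; rewrite /g subnK //; case: eqP => // Wi.
by case/eqP: ne; apply: val_inj.
Qed.

Lemma irrelevantP r : m r <-> cf r 0%N = 0.
Proof.
split=> [|r0].
  apply: (smallest_sub (X := [set r | cf r 0%N = 0])) => [|x [i ai /= ->]].
    split=> [|c u v /= u0 v0]; first by rewrite /= rmorph0.
    by rewrite rmorphD -[c *: u]/(c * u) rmorphM fps_coefD fps_coefM0 u0 v0 mulr0 addr0.
  by rewrite fpsXE; case: eqP => // i0; have [] := generatorP a_gen ai; rewrite -i0.
have [X XE] := exists_atom_family.
have [g ->] := sgring_decomposition XE r0.
apply: (ideal_sum (I := m)) => [|i _]; first exact: ideal_span_ideal.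
apply: (ideal_mul (I := m)); first exact: ideal_span_ideal.
apply: sub_gen_smallest; exists (nth 0%N (atoms a) i) => //.
by have := mem_nth 0%N (ltn_ord i); rewrite mem_filter => /andP[].
Qed.

(** * Minimal generators of the maximal ideal *)

Lemma irrelevant_ideal_ideal : ideal m. Proof. exact: ideal_span_ideal. Qed.

Lemma atoms_generate (X : 'I_N -> R) :
  (forall i, cf (X i) = fpsX (nth 0%N (atoms a) i)) -> generates X m.
Proof.
move=> XE; apply/seteqP; split=> r.
  case/ideal_spanP => g ->; apply: (ideal_sum (I := m)) => [|i _].
    exact: irrelevant_ideal_ideal.
  apply: (ideal_mul (I := m)); first exact: irrelevant_ideal_ideal.
  apply/irrelevantP; rewrite XE fpsXE; case: eqP => // w0.
  by have [_] := atom_mem i; rewrite -w0.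
by move=> /irrelevantP r0; apply/ideal_spanP/sgring_decomposition.
Qed.

(** An atom has only trivial decompositions and [y] has no constant term. Thus the coefficients at
    atoms are linear coordinates on [m / m^2]. *)
Lemma coefM_atom r y w : cf y 0%N = 0 -> atom S w -> cf (r * y) w = cf r 0%N * cf y w.
Proof.
move=> y0 [_ _ irr]; rewrite rmorphM fps_coefM big_ord_recl subn0 big1 ?addr0 //.
move=> i _; apply/eqP/negPn/negP; rewrite mulf_eq0 negb_or => /andP[/cf_supp Si].
rewrite lift0 => yn0; have Sw := cf_supp yn0; have lt_iw := ltn_ord i.
have := irr _ _ Si Sw; rewrite lift0 subnKC // => -[]// wi0.
by move: yn0; rewrite wi0 y0 eqxx.
Qed.

Definition coef_mx n (x : 'I_n -> R) : 'M[k]_(n, N) :=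
  \matrix_(i, j) cf (x i) (nth 0%N (atoms a) j).

Lemma generates_sub n (x : 'I_n -> R) i : generates x m -> cf (x i) 0%N = 0.
Proof.
by move=> xm; apply/irrelevantP; rewrite -xm; apply: sub_gen_smallest; exists i.
Qed.

Lemma coef_mx_lincomb n (x : 'I_n -> R) (r : 'I_n -> R) (j : 'I_N) :
    generates x m ->
  cf (\sum_(i < n) r i * x i) (nth 0%N (atoms a) j) =
  ((\row_i cf (r i) 0%N) *m coef_mx x) ord0 j.
Proof.
move=> xm; rewrite rmorph_sum fps_coef_sum mxE; apply: eq_bigr => i _ /=.
by rewrite coefM_atom ?mxE //; [apply: generates_sub|apply: atom_mem].
Qed.

(** Write the monomial generators as combinations of the [x i]; the constant terms of the
    coefficients form the left inverse. *)
Lemma coef_mx_left_inverse n (x : 'I_n -> R) :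
  generates x m -> exists A, A *m coef_mx x = 1%:M.
Proof.
move=> xm; have [X XE] := exists_atom_family.
have /choice[g gE] : forall i : 'I_N, exists gi : 'I_n -> R, X i = \sum_(j < n) gi j * x j.
  move=> i; apply/ideal_spanP; rewrite -/(generates x m) xm.
  apply/irrelevantP; rewrite XE fpsXE; case: eqP => // w0.
  by have [_] := atom_mem i; rewrite -w0.
exists (\matrix_(i, j) cf (g i j) 0%N); apply/row_matrixP => i; apply/rowP => j.
have := coef_mx_lincomb (g i) j xm; rewrite -gE XE fpsXE row_mul => cE.
rewrite !mxE nth_uniq ?atoms_uniq // in cE *.
rewrite eq_sym cE; apply: eq_bigr => l _; rewrite !mxE //.
Qed.

Lemma generators_ge n (x : 'I_n -> R) : generates x m -> (N <= n)%N.
Proof. by case/coef_mx_left_inverse => A /mulmx1_min. Qed.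

Lemma mu_irrelevant : mu m = N.
Proof.
have [X XE] := exists_atom_family; have Xm := atoms_generate XE.
apply: get_unique => [|n [[x xm] n_min]]; first by split; [exists X|move=> p y /generators_ge].
by apply/eqP; rewrite eqn_leq (generators_ge xm) (n_min _ _ Xm).
Qed.

(** A minimal family has as many members as there are atoms, so [coef_mx x] is square and
    invertible; it kills the row of constant terms of a cycle. *)
Lemma Z1_sub_irrelevant n (x : 'I_n -> R) (r : 'rV[R]_n) i :
  minimal_generators x m -> Z1 x r -> m (r ord0 i).
Proof.
case; rewrite mu_irrelevant => nE; subst n => xm Zr.
have [A Ax] := coef_mx_left_inverse xm.
apply/irrelevantP; suff /rowP/(_ i) : \row_i cf (r ord0 i) 0%N = 0 :> 'rV[k]_N by rewrite !mxE.
rewrite -[LHS]mulmx1 -(mulmx1C Ax) mulmxA (_ : _ *m coef_mx x = 0) ?mul0mx //.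
by apply/rowP => j; rewrite -(coef_mx_lincomb _ _ xm) Zr rmorph0 !mxE.
Qed.

(** * Order of vanishing and lengths of chains *)

Lemma exists_constant (v : k) : exists r, cf r = series_of_poly v%:P.
Proof.
apply/cfP; split=> [n|_]; last by apply/finsuppP; exists v%:P.
rewrite /series_of_poly coefC; case: (n =P 0%N) => [-> _|_]; last by rewrite eqxx.
exact: semigroup0.
Qed.

Definition order_ge j : set R := [set r | forall i, (i < j)%N -> cf r i = 0].

Lemma order_ge_ideal j : ideal (order_ge j).
Proof.
split=> [i _|c u v u0 v0 i lt_ij]; first by rewrite rmorph0.
rewrite rmorphD -[c *: u]/(c * u) rmorphM fps_coefD fps_coefM v0 // addr0.
rewrite big1 // => l _.
by rewrite u0 ?mulr0 //; lia.
Qed.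

Lemma order_geM i j x y : order_ge i x -> order_ge j y -> order_ge (i + j)%N (x * y).
Proof.
move=> x0 y0 n lt_n; rewrite rmorphM fps_coefM big1 // => l _.
case: (ltnP l i) => [/x0 ->|le_il]; first by rewrite mul0r.
by rewrite y0 ?mulr0 //; have := ltn_ord l; lia.
Qed.

Lemma strict_chain_mono T l (d : nat -> set T) i j :
  (forall i, (i < l)%N -> d i `<` d i.+1) -> (i <= j)%N -> (j <= l)%N -> d i `<=` d j.
Proof.
move=> d_lt; elim: j => [|j IH]; first by rewrite leqn0 => /eqP -> _ x.
rewrite leq_eqVlt ltnS => /predU1P[-> _ x //|le_ij] lt_jl.
by apply: subset_trans (IH le_ij (ltnW lt_jl)) _; case: (d_lt j lt_jl).
Qed.

(* Elements picked in the successive steps of a chain have linearly independent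
   truncations at order [D]. *)
Lemma chain_length_le (W : set R) l D :
  @submodule_chain R R^o W setT l -> order_ge D `<=` W -> (l <= D)%N.
Proof.
move=> [d [d0 dl d_sub d_lt]] DW.
have /choice[z zP] : forall i : 'I_l, exists z, d i.+1 z /\ ~ d i z.
  by move=> i; have [_ /existsNP[z /not_implyP[]]] := d_lt i (ltn_ord i); exists z.
have /choice[K KE] := exists_constant.
pose A : 'M[k]_(l, D) := \matrix_(i, j) cf (z i) j.
suff /eqP <- : row_free A by exact: rank_leq_col.
apply: inj_row_free => v vA; apply/eqP/negPn/negP => v0.
have [i1 vi1] : exists i, v ord0 i != 0.
  apply: contrapT => no; case/eqP: v0; apply/rowP => i; rewrite mxE.
  by apply/eqP/negPn/negP => vi; apply: no; exists i.
(* Let [i0] be the last index in a dependency [v]. The combination has order at least [D], so it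
   lies in [W], and the earlier [z i] lie in [d i0]; hence so does [z i0], contrary to its
   choice. *)
case: (@arg_maxnP _ i1 (fun i => v ord0 i != 0) (fun i => i : nat) vi1) => i0 vi0 i0_max.
have d_i0 : ideal (d i0) by apply: d_sub; rewrite ltnW.
have [_ nz] := zP i0; apply: nz.
have KV r : cf (K (v ord0 i0)^-1 * (K (v ord0 i0) * r)) = cf r.
  by rewrite !rmorphM !KE mulrA -rmorphM -polyCM mulVf // rmorph1 mul1r.
rewrite -(cf_inj (KV (z i0))); apply: ideal_mul => //.
have -> : K (v ord0 i0) * z i0 = \sum_i K (v ord0 i) * z i +
    - 1 * \sum_(i | i != i0) K (v ord0 i) * z i.
  by rewrite (bigD1 i0) //= mulN1r addrK.
apply: idealD => //; last first.
  apply: ideal_mul => //; apply: ideal_sum => // i ne.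
  have [vi|vi] := eqVneq (v ord0 i) 0.
    have -> : K (v ord0 i) = 0 by apply: cf_inj; rewrite KE vi !rmorph0.
    by rewrite mul0r; case: d_i0.
  apply: ideal_mul => //.
  have le_i : (i <= i0)%N by exact: i0_max.
  apply: (strict_chain_mono d_lt (_ : (i.+1 <= i0)%N)); last by case: (zP i).
    by rewrite ltn_neqAle le_i andbT.
  exact/ltnW.
have W_i0 : W `<=` d i0 by rewrite -d0; apply: (strict_chain_mono d_lt); rewrite // ltnW.
apply/W_i0/DW => j lt_j; have /rowP/(_ (Ordinal lt_j)) := vA.
rewrite !mxE => sum0; rewrite -[RHS]sum0 rmorph_sum fps_coef_sum; apply: eq_bigr => i _ /=.
rewrite mxE rmorphM KE fps_coefM big_ord_recl subn0 big1 ?addr0 //= => [|l' _].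
  by rewrite /series_of_poly coefC.
by rewrite /series_of_poly coefC mul0r.
Qed.

(** * The multiplicity of the maximal ideal *)

Section Multiplicity.
Variables e c : nat.
Hypotheses (Se : S e) (e_gt0 : (0 < e)%N).
Hypothesis e_min : forall s, S s -> (0 < s)%N -> (e <= s)%N.
Hypothesis Sc : forall n, (c <= n)%N -> S n.

Lemma irrelevant_order r : m r -> order_ge e r.
Proof.
move=> /irrelevantP r0 i lt_ie; apply/eqP/negPn/negP => ri.
have i_gt0 : (0 < i)%N by case: i ri {lt_ie} => //; rewrite r0 eqxx.
by have := e_min (cf_supp ri) i_gt0; lia.
Qed.

Lemma ideal_pow_order n : ideal_pow m n `<=` order_ge (e * n)%N.
Proof.
apply: smallest_sub => [|_ [x xm ->]]; first exact: order_ge_ideal.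
elim: n x xm => [|n IH] x xm; first by rewrite muln0.
rewrite big_ord_recl mulnS; apply: order_geM; first exact/irrelevant_order.
by apply: IH => i.
Qed.

(** Such a series is [t^(e n)] times a series of order at least [c], whose exponents all lie in
    [S]. *)
Lemma order_ideal_pow n : order_ge (e * n + c)%N `<=` ideal_pow m n.
Proof.
move=> r r0; have [t tE] := exists_monomial Se.
have [g gE] : exists g, cf g = shift (e * n)%N (cf r).
  apply/cfP; split=> [i|/(cf_fin r)[M rM]]; last by exists M => i le; apply: rM; lia.
  rewrite /shift => ri; apply: Sc; rewrite leqNgt.
  by apply: contra_neqN ri => lt; apply: r0; lia.
have -> : r = g * \prod_(i < n) t.
  apply: cf_inj; rewrite rmorphM gE prodr_const card_ord rmorphXn tE fpsXn mulrC shiftK //.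
  by move=> i lt_i; apply: r0; lia.
apply: (ideal_mul (I := ideal_pow m n)); first exact: ideal_span_ideal.
apply: sub_gen_smallest; exists (fun=> t) => // _; apply/irrelevantP.
by rewrite tE fpsXE; case: eqP e_gt0 => // <-.
Qed.

(** As [j] decreases to 0, each exponent in [S] gives a strict inclusion, witnessed by a monomial;
    the gaps of [S] give equalities, and all are below [c]. *)
Lemma order_chain (W : set R) j l : @submodule_chain R R^o W (order_ge j) l ->
  exists2 l', @submodule_chain R R^o W setT l' & (l + (j - c) <= l')%N.
Proof.
elim: j l => [|j IH] l Wl.
  have <- : order_ge 0 = setT by apply/seteqP; split.
  by exists l => //; lia.
have [Sj|nSj] := pselect (S j).
  have [|l' Wl' le] := IH l.+1; last by exists l' => //; lia.
  apply: chain_extend Wl _ _; first exact: order_ge_ideal.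
  split=> [r r0 i lt|sub]; first by apply: r0; lia.
  have [t tE] := exists_monomial Sj.
  have := sub t _ j (ltnSn j); rewrite tE fpsXE eqxx => t0.
  suff /t0/eqP : order_ge j t by rewrite oner_eq0.
  by move=> i lt; rewrite tE fpsXE ltn_eqF.
have lt_jc : (j < c)%N by rewrite ltnNge; apply/negP => /Sc.
have eq_j : order_ge j.+1 = order_ge j.
  apply/seteqP; split=> r r0 i lt; first by apply: r0; lia.
  move: lt; rewrite ltnS leq_eqVlt => /predU1P[->|/r0//].
  by apply/eqP/negPn/negP => /cf_supp.
rewrite eq_j in Wl; have [l' Wl' le] := IH l Wl; exists l' => //; lia.
Qed.

Lemma has_multiplicity_min M : has_multiplicity m M -> M = e.
Proof.
move=> [P [M0 [PM ME]]].
(* [m^n] contains all elements of order at least [e n + c] and only elements of order at least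
   [e n], so its colength is within [c] of [e n]. *)
have [|b PE] := @poly_linear_growth P e c M0.
  move=> n /PM[l [l_chain l_max] Pl]; exists l => //; split; last first.
    exact: chain_length_le l_chain (@order_ideal_pow n).
  have [l0 chain_l0] : exists l0,
      @submodule_chain R R^o (ideal_pow m n) (order_ge (e * n)%N) l0.
    have pow_id : ideal (ideal_pow m n) by exact: ideal_span_ideal.
    have chain0 : @submodule_chain R R^o (ideal_pow m n) (ideal_pow m n) 0.
      by exists (fun=> ideal_pow m n).
    have [<-|ne] := pselect (ideal_pow m n = order_ge (e * n)%N); first by exists 0%N.
    exists 1%N; apply: chain_extend chain0 _ _; first exact: order_ge_ideal.
    split; first exact: ideal_pow_order.
    by move=> sub; apply: ne; apply/seteqP; split=> //; apply: ideal_pow_order.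
  have [l' chain_l' le] := order_chain chain_l0.
  have := l_max _ chain_l'; lia.
apply/eqP; rewrite -(eqr_nat rat) ME PE; apply/eqP.
exact: linear_growth_multiplicity.
Qed.

End Multiplicity.

(** * The endomorphism ring of the maximal ideal *)

Definition in_max (f : fps k) := exists2 r, m r & cf r = f.

Lemma in_maxP f : in_max f <-> admissible fin S f /\ f 0%N = 0.
Proof.
split=> [[r /irrelevantP r0 <-]|[/cfP[r rE] f0]].
  by split=> //; apply/cfP; exists r.
by exists r => //; apply/irrelevantP; rewrite rE.
Qed.

Lemma in_maxD f g : in_max f -> in_max g -> in_max (f + g).
Proof.
move=> [r mr <-] [s ms <-]; exists (r + s); last by rewrite rmorphD.
exact: idealD irrelevant_ideal_ideal mr ms.
Qed.

Lemma in_maxN f : in_max f -> in_max (- f).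
Proof.
move=> [r mr <-]; exists (- 1 * r); last by rewrite mulN1r rmorphN.
exact: ideal_mul irrelevant_ideal_ideal mr.
Qed.

(** The value is 0 for series outside the image of [m]. *)
Definition lift_max (f : fps k) : R := xget 0 [set r | m r /\ cf r = f].

Lemma lift_maxP f : in_max f -> m (lift_max f) /\ cf (lift_max f) = f.
Proof.
case=> r mr rE; exact: (@xgetI _ 0 [set r | m r /\ cf r = f] r (conj mr rE)).
Qed.

Section EndomorphismRing.
Variable e : nat.
Hypotheses (Se : S e) (e_gt0 : (0 < e)%N).
Hypothesis e_min : forall s, S s -> (0 < s)%N -> (e <= s)%N.
Hypothesis S_sub : forall s s', S s -> (0 < s)%N -> S s' -> (0 < s')%N ->
  exists2 t, S t & (0 < t)%N /\ (s + s' = t + e)%N.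

(* The exponents of the ring [m : m = t^(-e) m]. *)
Definition stable_exponent : set nat := [set n | S (n + e)%N].
Local Notation T := stable_exponent.

(** [S_sub] applied to [i + e] and [j + e] gives [i + j + 2 e = t + e] with [t] in [S]. *)
Lemma stable_exponentD i j : T i -> T j -> T (i + j)%N.
Proof.
move=> Ti Tj; have [||t St [_ tE]] := S_sub Ti _ Tj _; try lia.
by rewrite /T /= (_ : (i + j + e = t)%N) //; lia.
Qed.

Lemma sub_stable_exponent : S `<=` T.
Proof. by move=> n Sn; apply: semigroupD. Qed.

Lemma in_maxM b f : admissible fin T b -> in_max f -> in_max (b * f).
Proof.
move=> [Tb bfin] /in_maxP[[Sf ffin] f0]; apply/in_maxP; split; last first.
  by rewrite fps_coefM0 f0 mulr0.
split; last by move=> h; apply: finsuppM; [apply: bfin|apply: ffin].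
have Sf' : supported (fun n => S n /\ (0 < n)%N) f.
  by move=> n fn; split; [apply: Sf|case: n fn => //; rewrite f0 eqxx].
apply: supportedM Tb Sf' => i j Ti [Sj j_gt0].
have [|t St [_ tE]] := S_sub Ti _ Sj j_gt0; first lia.
by rewrite (_ : (i + j = t)%N) //; lia.
Qed.

(** Subtracting [c_i r_l] from the coordinates other than [r_j] and [r_l] turns the relation into
    [r_j y_j + r_l h + G = 0], where [G] depends only on the new coordinates. The pair [r_l], [r_j]
    is replaced by the single entry [F_0 = u r_l - v r_j]. *)
Lemma Z1_reduction_iso p (x : 'I_p.+2 -> R) (y : 'I_p.+2 -> fps k) j
    (c : 'I_p.+1 -> fps k) u v :
    (forall r i, Z1 x r -> m (r ord0 i)) ->
    (forall i, cf (x i) = fpsX e * y i) -> (forall i, admissible fin T (y i)) ->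
    c ord0 = 1 -> (forall i, admissible fin T (c i)) ->
    admissible fin T u -> admissible fin T v ->
    u * y j + v * \sum_i c i * y (lift j i) = 1 ->
  submodule_iso (Z1 x) (ideal_dsum m p.+1).
Proof.
move=> Z1m xE Ty c0 Tc Tu Tv uv; set h := \sum_i _ in uv.
have Th : admissible fin T h.
  by apply: admissible_sum => i _; apply: (admissibleM stable_exponentD).
pose l := lift j (ord0 : 'I_p.+1).
pose F (r : 'rV[R]_p.+2) (i : 'I_p.+1) : fps k :=
  if i == ord0 then u * cf (r ord0 l) - v * cf (r ord0 j)
  else cf (r ord0 (lift j i)) - c i * cf (r ord0 l).
pose f (r : 'rV[R]_p.+2) : 'rV[R]_p.+1 := \row_i lift_max (F r i).
have F_max r i : Z1 x r -> in_max (F r i).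
  move=> Zr; have Mr i' : in_max (cf (r ord0 i')) by exists (r ord0 i') => //; apply: Z1m.
  rewrite /F; case: ifP => _; apply: in_maxD => //; first exact: in_maxM.
    by apply/in_maxN/in_maxM.
  by apply/in_maxN/in_maxM.
have fE r i : Z1 x r -> cf (f r ord0 i) = F r i.
  by move=> Zr; rewrite mxE; case: (lift_maxP (F_max r i Zr)).
have Z1P r : Z1 x r <->
    cf (r ord0 j) * y j + \sum_i cf (r ord0 (lift j i)) * y (lift j i) = 0.
  rewrite /Z1 /= (bigD1_ord j) //=; set L := (X in X = 0 <-> _).
  have -> : L = 0 <-> cf L = 0.
    by split=> [->|L0]; [rewrite rmorph0|apply: cf_inj; rewrite rmorph0].
  have -> : cf L = fpsX e *
      (cf (r ord0 j) * y j + \sum_i cf (r ord0 (lift j i)) * y (lift j i)).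
    rewrite /L rmorphD rmorph_sum rmorphM xE mulrDr mulr_sumr /=; congr (_ + _); first by ring.
    by apply: eq_bigr => i _; rewrite rmorphM xE; ring.
  by split=> [L0|->]; [apply: (@fpsX_inj k e); rewrite /= L0 mulr0|rewrite mulr0].
have hE : h = y l + \sum_(i < p.+1 | i != ord0) c i * y (lift j i).
  by rewrite /h (bigD1 ord0) //= c0 mul1r.
pose G (w : 'I_p.+1 -> fps k) := \sum_(i < p.+1 | i != ord0) w i * y (lift j i).
have GF r : Z1 x r -> G (F r) = - (cf (r ord0 j) * y j + cf (r ord0 l) * h).
  move=> /Z1P; rewrite (bigD1 ord0) //= -/l => Zr.
  have -> : G (F r) = \sum_(i < p.+1 | i != ord0) cf (r ord0 (lift j i)) * y (lift j i)
      - cf (r ord0 l) * \sum_(i < p.+1 | i != ord0) c i * y (lift j i).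
    rewrite /G mulr_sumr -sumrB; apply: eq_bigr => i /negPf ne; rewrite /F ne; ring.
  move/eqP: Zr; rewrite addr_eq0 => /eqP ->; rewrite hE; ring.
(* Cramer's rule for [u r_l - v r_j = F_0], [h r_l + y_j r_j = - G], a system of determinant
   [u y_j + v h = 1]. *)
have l_coef r : Z1 x r -> cf (r ord0 l) = F r ord0 * y j - v * G (F r).
  move=> Zr; rewrite GF // /F eqxx -[LHS]mulr1 -uv; ring.
have j_coef r : Z1 x r -> cf (r ord0 j) = - (F r ord0 * h) - u * G (F r).
  move=> Zr; rewrite GF // /F eqxx -[LHS]mulr1 -uv; ring.
exists f; first split.
- by move=> r Zr i; rewrite mxE; case: (lift_maxP (F_max r i Zr)).
- move=> r s /set_mem Zr /set_mem Zs frs.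
  have Frs i : F r i = F s i by rewrite -!fE // frs.
  have Grs : G (F r) = G (F s) by apply: eq_bigr => i _; rewrite Frs.
  have lrs : cf (r ord0 l) = cf (s ord0 l) by rewrite !l_coef // Grs Frs.
  apply/rowP => i; apply: cf_inj; have [i' ->|->] := unliftP j i; last first.
    by rewrite !j_coef // Grs Frs.
  have [->|/negPf ne] := eqVneq i' ord0; first exact: lrs.
  have := Frs i'; rewrite /F ne lrs; exact: addIr.
- move=> s ms; pose w i := cf (s ord0 i).
  have Mw i : in_max (w i) by exists (s ord0 i) => //; apply: ms.
  have MG : in_max (G w).
    rewrite /G; elim/big_rec: _ => [|i g _ Mg].
      by apply/in_maxP; split=> //; apply: admissible0.
    by apply: in_maxD Mg; rewrite mulrC; apply: in_maxM.
  (* The same solution formulas, applied to an arbitrary row [w] in [m], define the preimage. *)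
  pose rl := w ord0 * y j - v * G w.
  pose rj := - (w ord0 * h) - u * G w.
  pose rf i := oapp (fun i' => if i' == ord0 then rl else w i' + c i' * rl) rj (unlift j i).
  have Mrl : in_max rl.
    apply: in_maxD; first by rewrite mulrC; apply: in_maxM.
    by apply/in_maxN/in_maxM.
  have Mrf i : in_max (rf i).
    rewrite /rf; case: unliftP => [i' _|_] /=; last first.
      by apply: in_maxD; apply: in_maxN; [rewrite mulrC|]; apply: in_maxM.
    by case: ifP => // _; apply: in_maxD => //; apply: in_maxM.
  pose r : 'rV[R]_p.+2 := \row_i lift_max (rf i).
  have rE i : cf (r ord0 i) = rf i by rewrite mxE; case: (lift_maxP (Mrf i)).
  have rjE : cf (r ord0 j) = rj by rewrite rE /rf unlift_none.
  have rlE : cf (r ord0 l) = rl by rewrite rE /rf liftK.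
  have riE i : i != ord0 -> cf (r ord0 (lift j i)) = w i + c i * rl.
    by move=> /negPf ne; rewrite rE /rf liftK /= ne.
  have Zr : Z1 x r.
    apply/Z1P; rewrite (bigD1 ord0) //= -/l rjE rlE.
    have -> : \sum_(i < p.+1 | i != ord0) cf (r ord0 (lift j i)) * y (lift j i) =
        G w + rl * \sum_(i < p.+1 | i != ord0) c i * y (lift j i).
      rewrite /G mulr_sumr -big_split; apply: eq_bigr => i ne /=; rewrite riE //; ring.
    transitivity (rj * y j + rl * h + G w); first by rewrite hE; ring.
    transitivity (G w * (1 - (u * y j + v * h))); first by rewrite /rj /rl; ring.
    by rewrite uv subrr mulr0.
  exists r => //; apply/rowP => i; apply: cf_inj; rewrite fE // /F.
  case: eqP => [->|/eqP ne]; last by rewrite riE // rlE; ring.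
  rewrite rlE rjE -/(w ord0) -[RHS]mulr1 -uv /rl /rj; ring.
- move=> b r s Zr Zs; apply/rowP => i; apply: cf_inj.
  have Zbrs : Z1 x (b *: r + s) by case: (Z1_submodule x) => _; apply.
  rewrite fE // !mxE rmorphD rmorphM -[cf (lift_max _)]/(cf (lift_max (F r i))).
  have [_ ->] := lift_maxP (F_max r i Zr); have [_ ->] := lift_maxP (F_max s i Zs).
  by rewrite /F; case: ifP => _; rewrite !mxE !rmorphD !rmorphM; ring.
Qed.

Lemma Z1_iso_of_minimal_multiplicity p (x : 'I_p.+2 -> R) :
    rows_reducible k fin -> minimal_generators x m ->
  submodule_iso (Z1 x) (ideal_dsum m p.+1).
Proof.
move=> red x_min; have [_ xm] := x_min; have [c Sc] := semigroup_cofinite a_gen.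
pose y i := shift e (cf (x i)).
have shiftE r : m r -> cf r = fpsX e * shift e (cf r).
  move=> /irrelevantP r0; rewrite shiftK // => i lt_ie; apply/eqP/negPn/negP => ri.
  have i_gt0 : (0 < i)%N by case: i ri {lt_ie} => //; rewrite r0 eqxx.
  by have := e_min (cf_supp ri) i_gt0; lia.
have xE i : cf (x i) = fpsX e * y i.
  by apply: shiftE; apply/irrelevantP/generates_sub.
have Ty i : admissible fin T (y i).
  split=> [n /cf_supp //|/(cf_fin (x i))[M xM]].
  by exists M => n le; apply: xM; lia.
have [t tE] := exists_monomial Se.
(* [t^e] is a combination of the [x i = t^e y i]; cancelling [t^e] shows that the row [y] is
   unimodular. *)
have /ideal_spanP[r rE] : ideal_span (range x) t.
  by rewrite xm; apply/irrelevantP; rewrite tE fpsXE; case: eqP e_gt0 => // <-.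
have Tc n : (c <= n)%N -> T n by move=> le; apply: Sc; lia.
have [||j [d [u [v [d0 Td Tu Tv uv]]]]] := red T c Se stable_exponentD Tc p y (cf \o r) Ty.
- move=> i; split=> [n /cf_supp Sn|/(cf_fin (r i))//]; exact: sub_stable_exponent.
- apply: (@fpsX_inj k e); rewrite /= mulr1 -[RHS]tE rE rmorph_sum mulr_sumr.
  by apply: eq_bigr => i _ /=; rewrite rmorphM xE; ring.
apply: Z1_reduction_iso xE Ty d0 Td Tu Tv uv.
by move=> s i; apply: Z1_sub_irrelevant.
Qed.

End EndomorphismRing.

Theorem minimal_multiplicity_Z1_iso n (x : 'I_n -> R) :
    ~ S 1%N -> rows_reducible k fin -> minimal_generators x m ->
  minimal_multiplicity m <->
  submodule_iso (Z1 x) (ideal_dsum m (multiplicity m - 1)%N).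
Proof.
move=> nS1 red x_min; have [nE xm] := x_min.
have n_gt1 : (1 < n)%N by rewrite nE mu_irrelevant; apply: size_atoms_gt1.
case: n n_gt1 x nE xm x_min => [|[|p]] // _ x nE xm x_min; split; last first.
  have [e [Se e_gt0 _]] := semigroup_min a_gen; have [t tE] := exists_monomial Se.
  have t0 : t <> 0.
    move=> t0; have := fpsXE k e e; rewrite -tE t0 rmorph0 eqxx => /eqP.
    by rewrite eq_sym oner_eq0.
  have mt : m t by apply/irrelevantP; rewrite tE fpsXE; case: eqP e_gt0 => // <-.
  have [j xj0] : exists j, x j <> 0.
    apply: contrapT => no; move: mt; rewrite -xm => /ideal_spanP[r rE].
    apply: t0; rewrite rE big1 // => i _; have [->|xi] := pselect (x i = 0).
      by rewrite mulr0.
    by case: no; exists i.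
  move=> /(Z1_iso_rank sgring_integral xj0 irrelevant_ideal_ideal mt t0) pE.
  (* The truncated difference [multiplicity m - 1] equals [p + 1 > 0], so the multiplicity is
     [p + 2]. *)
  by rewrite /minimal_multiplicity -nE; lia.
rewrite /minimal_multiplicity -nE => multE; rewrite multE subn1 /=.
(* [get] would return 0 if no multiplicity existed, but its value here is [p + 2]. *)
have [M multM] : exists M, has_multiplicity m M.
  apply: contrapT => no; have := getPN (P := has_multiplicity m) _.
  by rewrite -/(multiplicity m) multE => /(_ (fun M h => no (ex_intro _ M h))).
have [e [Se e_gt0 e_min]] := semigroup_min a_gen; have [c Sc] := semigroup_cofinite a_gen.
have mult_e : multiplicity m = e.
  by apply: (has_multiplicity_min Se e_gt0 e_min Sc); apply: getPex; exists M.
apply: (Z1_iso_of_minimal_multiplicity Se e_gt0 e_min) => // s s'.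
by apply: minimal_multiplicity_sub => //; rewrite -mult_e multE nE mu_irrelevant.
Qed.

End SemigroupRing.

(** * The graded and the complete case *)

Section Instances.
Variables (k : fieldType) (a : seq nat).
Hypothesis a_gen : numerical_generators a.
Local Notation S := (semigroup a).
Local Notation P := (poly_sgring k a).
Local Notation Q := (series_sgring k a).

Definition poly_coef : {rmorphism P -> fps k} := @series_of_poly k \o val.
Definition series_coef : {rmorphism Q -> fps k} := val.

Lemma poly_coef_inj : injective poly_coef.
Proof. by move=> p q /series_of_poly_inj/val_inj. Qed.

Lemma poly_coefP f : (exists r, poly_coef r = f) <-> admissible True S f.
Proof.
have Ua := generators_uniq a_gen; split=> [[r <-]|[Sf /(_ I)/finsuppP[p fE]]].
  split=> [n|_]; last by apply/finsuppP; exists (val r).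
  exact: (poly_subalgP _ Ua).1 (set_mem (poly_sgvalP r)) n.
have Sp : p \in in_poly_subalg a.
  by apply/mem_set/poly_subalgP => // n pn; apply: Sf; rewrite fE.
by exists (PolySgring Sp); rewrite fE.
Qed.

Lemma poly_maxE : poly_max k a = irrelevant_ideal a poly_coef.
Proof.
congr ideal_span; apply/seteqP; split=> x [i ai xE]; exists i => //.
  by rewrite /poly_coef /= xE.
exact: series_of_poly_inj.
Qed.

Lemma series_coef_inj : injective series_coef.
Proof. exact: val_inj. Qed.

Lemma series_coefP f : (exists r, series_coef r = f) <-> admissible False S f.
Proof.
have Ua := generators_uniq a_gen; split=> [[r <-]|[Sf _]].
  split=> [n|//]; exact: (series_subalgP _ Ua).1 (set_mem (series_sgvalP r)) n.
have Sp : f \in in_series_subalg a by apply/mem_set/series_subalgP.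
by exists (SeriesSgring Sp).
Qed.

Lemma semigroup_full n : S 1%N -> S n.
Proof. by move=> S1; rewrite -[n]muln1; apply: semigroup_mul. Qed.

Lemma poly_subalg_full : S 1%N -> poly_subalg k a = setT.
Proof.
move=> S1; apply/seteqP; split=> // p _; apply/poly_subalgP => [|n _].
  exact: generators_uniq.
exact: semigroup_full.
Qed.

(** Here every exponent is allowed and the ring is all of [k[[t]]]; by contraposition, a ring that
    is not a DVR has [~ S 1]. *)
Lemma series_DVR : S 1%N -> is_DVR Q.
Proof.
move=> S1; have lift f : exists r, series_coef r = f.
  by apply/series_coefP; split=> // n _; apply: semigroup_full.
have unit_ideal (I : set Q) r : ideal I -> I r -> series_coef r 0%N != 0 -> I = setT.
  move=> I_id Ir /fps_inv[g rg]; have [s sE] := lift g.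
  apply/seteqP; split=> // q _; have -> : q = (q * s) * r.
    apply: series_coef_inj; rewrite !rmorphM sE -mulrA [g * _]mulrC rg.
    by rewrite mulr1.
  exact: ideal_mul.
pose M : set Q := [set r | series_coef r 0%N = 0].
have M_ideal : ideal M.
  split=> [|c u v]; rewrite /M /mkset; first by rewrite rmorph0.
  move=> u0 v0; rewrite rmorphD -[c *: u]/(c * u) rmorphM fps_coefD fps_coefM0.
  by rewrite u0 v0 mulr0 addr0.
have M_proper : M <> setT.
  move=> MT; have : M 1 by rewrite MT.
  by rewrite /M /mkset rmorph1 fps_coef1 => /eqP; rewrite oner_eq0.
have M_top J : ideal J -> J <> setT -> J `<=` M.
  move=> J_id JT r Jr; apply/eqP/negPn/negP => r0.
  by apply: JT; apply: unit_ideal Jr r0.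
split.
- exact: sgring_integral series_coef_inj.
- move=> I I_id; have [[r Ir r0]|no] := pselect (exists2 r, I r & r <> 0); last first.
    exists 0; apply/seteqP; split=> r Ir.
      have [->|r0] := pselect (r = 0); last by case: no; exists r.
      by case: (ideal_span_ideal [set (0 : Q)]).
    by apply: Ir; split=> // _ ->; case: I_id.
  (* The least such [d] is the least order in [I]; an element [x] of this order generates [I],
     because [shift d x] is a unit. *)
  pose D d := `[< exists2 r, I r & series_coef r d <> 0 >].
  have exD : exists d, D d.
    apply: contrapT => nD; apply: r0; apply: series_coef_inj; apply: fpsP => n.
    rewrite rmorph0; apply/eqP/negPn/negP => rn; apply: nD; exists n; apply/asboolP.
    by exists r => //; apply/eqP.
  case: (ex_minnP exD) => d /asboolP[x Ix /eqP xd] d_min.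
  have low q : I q -> forall i, (i < d)%N -> series_coef q i = 0.
    move=> Iq i lt_id; apply/eqP/negPn/negP => qi.
    have : (d <= i)%N by apply: d_min; apply/asboolP; exists q => //; apply/eqP.
    by rewrite leqNgt lt_id.
  have [g xg] : exists g, shift d (series_coef x) * g = 1 by apply: fps_inv.
  exists x; apply/seteqP; split=> q Iq; last first.
    by apply: Iq; split=> // _ ->.
  have [s sE] := lift (g * shift d (series_coef q)).
  have -> : q = s * x.
    apply: series_coef_inj; rewrite rmorphM sE -[LHS](shiftK (low q Iq)).
    rewrite -[in RHS](shiftK (low x Ix)) -[LHS]mulr1 -xg; ring.
  by apply: (ideal_mul (I := ideal_span [set x]));
    [apply: ideal_span_ideal|apply: sub_gen_smallest].
- exists M; split.
  + split=> // J J_id MJ; have [->|JT] := pselect (J = setT); [by right|left].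
    by apply/seteqP; split=> //; apply: M_top.
  + have [t tE] := lift (fpsX 1); move=> M0; have : M t by rewrite /M /mkset tE fpsXE.
    rewrite M0 => t0; have := fpsXE k 1 1; rewrite -tE t0 rmorph0 => /eqP.
    by rewrite eq_sym oner_eq0.
  + move=> M' [M'_id M'T M'_max].
    by have [] := M'_max M M_ideal (M_top M' M'_id M'T).
Qed.

End Instances.

Theorem theorem1p4 (k : fieldType) (a : seq nat) :
  numerical_generators a ->
  (poly_subalg k a <> setT ->
   forall (n : nat) (x : 'I_n -> poly_sgring k a),
     minimal_generators x (poly_max k a) ->
     (minimal_multiplicity (poly_max k a) <->
      submodule_iso (Z1 x)
        (ideal_dsum (poly_max k a) (multiplicity (poly_max k a) - 1)%N))) /\
  (~ is_DVR (series_sgring k a) ->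
   forall (n : nat) (x : 'I_n -> series_sgring k a),
     minimal_generators x (series_max k a) ->
     (minimal_multiplicity (series_max k a) <->
      submodule_iso (Z1 x)
        (ideal_dsum (series_max k a) (multiplicity (series_max k a) - 1)%N))).
Proof.
move=> a_gen; split=> not_dvr n x.
  rewrite poly_maxE => x_min.
  apply: (minimal_multiplicity_Z1_iso a_gen (@poly_coef_inj k a) (poly_coefP a_gen)) => //.
    by move=> S1; apply/not_dvr/poly_subalg_full.
  exact: poly_rows_reducible.
move=> x_min.
apply: (minimal_multiplicity_Z1_iso a_gen (@series_coef_inj k a) (series_coefP a_gen)) => //.
  by move=> S1; apply/not_dvr/series_DVR.
by apply: series_rows_reducible => -[].
Qed.
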